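(* Let $q\ge 1$ be an integer, $p\in(1,2]$, $\Delta>0$, $L_{1:q}=(L_1,\dots,L_q)$ and $\sigma_{1:q}=(\sigma_1,\dots,\sigma_q)$ with positive entries, and let $\varepsilon>0$ satisfy $\varepsilon\le \mathcal O(\sigma_1)$. Put $$M_\varepsilon:=\min\Big\{\min_{r\in\{2,\dots,q\}}\Big(\frac{\sigma_r}{\sigma_1}\Big)^{\frac1{r-1}},\ \min_{r'\in\{1,\dots,q\}}\Big(\frac{L_{r'}}{\varepsilon}\Big)^{\frac1{r'}}\Big\}$$ (a minimum over the empty set is $+\infty$). Then there exist a function $F\in\mathcal F(\Delta,L_{1:q})$ and a stochastic $q$-th order oracle $\mathrm O^q_F\in\mathcal O_q(F,\sigma_{1:q})$ such that for every $q$-th order zero-respecting algorithm, the number of oracle queries required to find an $\varepsilon$-stationary point of $F$ (with constant probability) is at least $$\Omega(1)\cdot\frac{\Delta}{\varepsilon}\Big(\frac{\sigma_1}{\varepsilon}\Big)^{\frac{p}{p-1}}M_\varepsilon .$$ Moreover, this lower bound is realized by a construction $F:\mathbb R^d\to\mathbb R$ of dimension $d=\Theta\big(\frac{\Delta}{\varepsilon}M_\varepsilon\big)$.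
   Context: **Function class.** $\mathcal F(\Delta,L_{1:q})$ is the class of $q$-times differentiable functions $F:\mathbb R^d\to\mathbb R$ (for some $d$) with $F(0)-F^*\le\Delta$, where $F^*=\inf_x F(x)$, and $\|\nabla^rF(x)-\nabla^rF(y)\|_{\mathrm{op}}\le L_r\|x-y\|$ for all $x,y\in\mathbb R^d$ and all $r\in[q]:=\{1,\dots,q\}$. **Oracle class.** A stochastic $q$-th order oracle for $F$ returns, for a query $x$ and a fresh independent sample $\xi\sim\mathcal D$, the tuple $\mathrm O^q_F(x,\xi)=(f(x,\xi),\nabla f(x,\xi),\dots,\nabla^q f(x,\xi))$ with $\mathbb E_\xi[f(x,\xi)]=F(x)$ and $\mathbb E_\xi[\nabla^rf(x,\xi)]=\nabla^rF(x)$ for $r\in[q]$ (here $\nabla^r f(x,\xi)$ denotes the oracle's estimator of the $r$-th derivative). $\mathcal O_q(F,\sigma_{1:q})$ is the set of all such oracles with $\mathbb E_\xi\big[\|\nabla^rf(x,\xi)-\nabla^rF(x)\|_{\mathrm{op}}^p\big]\le\sigma_r^p$ for all $r\in[q]$ and $x\in\mathbb R^d$. **Support.** For a tensor $T$ of order $k$ over $\mathbb R^d$, $\operatorname{supp}\{T\}=\{i\in[d]: T_i\ne0\}$, where $T_i$ is the order-$(k-1)$ tensor $[T_i]_{j_1,\dots,j_{k-1}}=T_{i,j_1,\dots,j_{k-1}}$. The support of an oracle answer is the union of the supports of its derivative estimators. **Zero-respecting algorithm.** A (possibly randomized) $q$-th order algorithm, querying the oracle at points $x^0,x^1,\dots$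 with samples $\xi^0,\xi^1,\dots$, is zero-respecting if for every $F$ and every $q$-th order oracle, with probability one, $\operatorname{supp}\{x^t\}\subset\bigcup_{i<t}\operatorname{supp}\{\mathrm O^q_F(x^i,\xi^i)\}$ for all $t\in\mathbb N=\{0,1,\dots\}$ (in particular $x^0=0$). **Stationarity and the meaning of the bound.** A point $x$ is $\varepsilon$-stationary if $\|\nabla F(x)\|\le\varepsilon$. ''At least $N$ queries are required (with constant probability)'' means: with at least a universal constant positive probability, none of the points $x^t$ with $t\le N$ produced by the algorithm is $\varepsilon$-stationary. **Asymptotic notation.** $\mathcal O,\Omega,\Theta$ are sample-complexity notations that record the dominating term in the target accuracy $\varepsilon$ (i.e. they are read for all sufficiently small $\varepsilon$, the threshold being allowed to depend on $\Delta,L_{1:q},\sigma_{1:q},p,q$). The multiplicative constants hidden in them depend only on $p$ and $q$, never on $\varepsilon,\Delta,L_{1:q},\sigma_{1:q}$. *)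

(* Defs.v *)
From HB Require Import structures.
From mathcomp Require Import all_boot all_order all_algebra.
From mathcomp Require Import all_classical all_reals all_analysis.

Set Implicit Arguments.
Unset Strict Implicit.
Unset Printing Implicit Defensive.

Import Order.TTheory GRing.Theory Num.Theory.
Import numFieldNormedType.Exports.

Local Open Scope classical_set_scope.
Local Open Scope ring_scope.

(* Points of R^d are row vectors; the norm that the
   library puts on them is the sup norm, so the Euclidean norm is defined here.
   The two norms induce the same topology and the same (Frechet)
   differentiability. *)
Definition enorm (R : realType) (d : nat) (x : 'rV[R]_d) : R :=
  Num.sqrt (\sum_(i < d) x 0 i ^+ 2).

(* An order-k tensor, given by its entries T_(i_1, ..., i_k); no symmetry is
   imposed. *)
Definition tensor (R : realType) (d k : nat) := k.-tuple 'I_d -> R.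

Definition slice (R : realType) (d k : nat) (T : tensor R d k.+1) (i : 'I_d) :
  tensor R d k := fun t => T (cons_tuple i t).

Definition tsupp (R : realType) (d k : nat) (T : tensor R d k.+1) : set 'I_d :=
  [set i | slice T i <> 0].

Definition vsupp (R : realType) (d : nat) (x : 'rV[R]_d) : set 'I_d :=
  [set i | x 0 i <> 0].

Definition tapply (R : realType) (d k : nat) (T : tensor R d k)
    (v : 'I_k -> 'rV[R]_d) : R :=
  \sum_(t : k.-tuple 'I_d) T t * \prod_(j < k) v j 0 (tnth t j).

Definition opnorm (R : realType) (d k : nat) (T : tensor R d k) : R :=
  sup [set `|tapply T v| | v in [set v : 'I_k -> 'rV[R]_d |
                                   forall j, enorm (v j) <= 1]].

(* partials F [:: i_1; ...; i_k] = d_(i_1) ... d_(i_k) F *)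
Definition partials (R : realType) (d : nat) (F : 'rV[R]_d -> R)
    (s : seq 'I_d) : 'rV[R]_d -> R :=
  foldr (fun i G x => 'D_(delta_mx 0 i : 'rV[R]_d) G x) F s.

(* F is q times Frechet differentiable on R^d: the entries of its derivative
   tensors of order < q are (Frechet) differentiable everywhere. *)
Definition times_differentiable (R : realType) (d q : nat)
    (F : 'rV[R]_d -> R) : Prop :=
  forall s : seq 'I_d, (size s < q)%N ->
  forall x : 'rV[R]_d, differentiable (partials F s) x.

Definition dtensor (R : realType) (d : nat) (F : 'rV[R]_d -> R) (k : nat)
    (x : 'rV[R]_d) : tensor R d k := fun t => partials F t x.
Arguments dtensor {R d} F k x t.

Definition grad (R : realType) (d : nat) (F : 'rV[R]_d -> R) (x : 'rV[R]_d) :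
  'rV[R]_d := \row_(i < d) partials F [:: i] x.

Definition stationary (R : realType) (d : nat) (eps : R) (F : 'rV[R]_d -> R)
  (x : 'rV[R]_d) : Prop := enorm (grad F x) <= eps.

(* [inf] is only meaningful for sets that are bounded below. *)
Definition function_class (R : realType) (d q : nat) (Delta : R) (L : nat -> R)
    (F : 'rV[R]_d -> R) : Prop :=
  [/\ times_differentiable q F,
      has_lbound (range F),
      F 0 - inf (range F) <= Delta &
      forall r, (1 <= r <= q)%N -> forall x y : 'rV[R]_d,
        opnorm (dtensor F r x - dtensor F r y) <= L r * enorm (x - y)].

(* The value f and the estimators of the derivatives; the component of index
   k < q is the estimator of the derivative of order k + 1. *)
Definition answer (R : realType) (d q : nat) : Type :=
  (R * (forall k : 'I_q, tensor R d k.+1))%type.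

Definition asupp (R : realType) (d q : nat) (a : answer R d q) : set 'I_d :=
  \bigcup_(k : 'I_q) tsupp (a.2 k).

Definition borel_rV (R : realType) (d : nat) :=
  g_sigma_algebraType (@open 'rV[R]_d).

(* The sigma-algebra on answers generated by the real coordinates. *)
Definition measurable_answer (R : realType) (d q : nat) :=
  g_sigma_algebraType
    (preimage_set_system setT (fun a : answer R d q => a.1)
       (@measurable _ (measurableTypeR R)) `|`
     \bigcup_(k : 'I_q) \bigcup_(t : k.+1.-tuple 'I_d)
       preimage_set_system setT (fun a : answer R d q => a.2 k t)
         (@measurable _ (measurableTypeR R))).

(* Joint measurability in (x, xi) is the usual regularity making the iterates
   of an algorithm random variables. *)
Record oracle (R : realType) (d q : nat) := Oracle {
  sample_display : measure_display ;
  sample : measurableType sample_display ;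
  sample_law : probability sample R ;
  respond : 'rV[R]_d -> sample -> answer R d q ;
  respond_measurable : measurable_fun setT
    (fun w : borel_rV R d * sample =>
       respond w.1 w.2 : measurable_answer R d q) }.
Arguments respond {R d q} o x s : rename.

Definition has_mean (R : realType) (dS : measure_display)
    (S : measurableType dS) (D : probability S R) (X : S -> R) (m : R) : Prop :=
  D.-integrable setT (EFin \o X) /\ ('E_D[X] = m%:E)%E.

Definition oracle_for (R : realType) (d q : nat) (F : 'rV[R]_d -> R)
    (O : oracle R d q) : Prop :=
  forall x : 'rV[R]_d,
    has_mean (sample_law O) (fun s => (respond O x s).1) (F x) /\
    forall (k : 'I_q) (t : k.+1.-tuple 'I_d),
      has_mean (sample_law O) (fun s => (respond O x s).2 k t)
        (dtensor F k.+1 x t).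

Definition oracle_class (R : realType) (d q : nat) (p : R) (sigma : nat -> R)
    (F : 'rV[R]_d -> R) (O : oracle R d q) : Prop :=
  oracle_for F O /\
  forall (x : 'rV[R]_d) (k : 'I_q),
    ('E_(sample_law O)
       [fun s => (opnorm ((respond O x s).2 k - dtensor F k.+1 x) `^ p)%R]
     <= (sigma k.+1 `^ p)%:E)%E.

(* A randomized algorithm draws one random seed and computes each query from
   the seed and the answers received so far. *)
Record algorithm (R : realType) (d q : nat) := Algorithm {
  seed_display : measure_display ;
  seed : measurableType seed_display ;
  seed_law : probability seed R ;
  next : seed -> seq (answer R d q) -> 'rV[R]_d ;
  next_measurable : forall t : nat, measurable_fun setT
    (fun w : seed * t.-tuple (measurable_answer R d q) =>
       next w.1 w.2 : borel_rV R d) }.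
Arguments next {R d q} a z h : rename.

Section Execution.
Context (R : realType) (d q : nat) (A : algorithm R d q) (O : oracle R d q).

Fixpoint answers (z : seed A) (xi : nat -> sample O) (t : nat) :
    seq (answer R d q) :=
  if t is t'.+1 then
    let h := answers z xi t' in rcons h (respond O (next A z h) (xi t'))
  else [::].

Definition query (z : seed A) (xi : nat -> sample O) (t : nat) : 'rV[R]_d :=
  next A z (answers z xi t).

(* The seed Z and the samples xi_0, xi_1, ... are independent, Z has law
   seed_law A and each xi_t has law sample_law O: every finite family
   (Z, xi_0, ..., xi_(n-1)) is distributed according to the product law. *)
Definition independent_inputs (dW : measure_display) (W : measurableType dW)
    (P : probability W R) (Z : W -> seed A) (xi : nat -> W -> sample O) :
    Prop :=
  [/\ measurable_fun setT Z,
      forall t, measurable_fun setT (xi t) &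
      forall (n : nat) (B : set (seed A)) (C : nat -> set (sample O)),
        measurable B -> (forall t, measurable (C t)) ->
        P (Z @^-1` B `&` \bigcap_(t in [set t | (t < n)%N]) (xi t @^-1` C t)) =
        (seed_law A B * \prod_(t < n) sample_law O (C t))%E].

End Execution.

Definition zero_respecting (R : realType) (d q : nat) (A : algorithm R d q) :
    Prop :=
  forall (F : 'rV[R]_d -> R) (O : oracle R d q),
    times_differentiable q F -> oracle_for F O ->
  forall (dW : measure_display) (W : measurableType dW) (P : probability W R)
    (Z : W -> seed A) (xi : nat -> W -> sample O),
    independent_inputs P Z xi ->
    {ae P, forall w, forall t : nat,
       vsupp (query (Z w) (xi^~ w) t) `<=`
       \bigcup_(i in [set i | (i < t)%N])
         asupp (respond O (query (Z w) (xi^~ w) i) (xi i w))}.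

(* "At least N queries are required with probability pi0", on every
   probability space carrying the seed of A and the samples of O. *)
Definition requires_queries (R : realType) (d q : nat) (F : 'rV[R]_d -> R)
    (O : oracle R d q) (A : algorithm R d q) (eps pi0 N : R) : Prop :=
  forall (dW : measure_display) (W : measurableType dW) (P : probability W R)
    (Z : W -> seed A) (xi : nat -> W -> sample O),
    independent_inputs P Z xi ->
    (pi0%:E <= P [set w | forall t : nat, (t%:R <= N)%R ->
                    ~ stationary eps F (query (Z w) (xi^~ w) t)])%E.

(* The minimum is taken in the extended reals, so that the empty one is +oo;
   for q >= 1 it is finite. *)
Definition M_eps (R : realType) (q : nat) (L sigma : nat -> R) (eps : R) : R :=
  fine (Order.min
    (\big[Order.min/+oo%E]_(2 <= r < q.+1)
       ((sigma r / sigma 1%N) `^ (r.-1%:R)^-1)%:E)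
    (\big[Order.min/+oo%E]_(1 <= r < q.+1)
       ((L r / eps) `^ (r%:R)^-1)%:E)).

(* Main.v *)
(* With [m = 2q + 2], the hard function is a rescaling [alpha * H (mu * x)] of
   the chain

     [H y = - sin y_0 - \sum_(i < d) (m sin^(m-1) y_i + sin^m y_i sin y_(i+1))]

   (with [y_d = 0]).  Each [dH/dy_i] is [- cos y_i] times a sum of nonnegative
   terms, one of which is [sin^m y_(i-1)] (or [1] if [i = 0]).  If some
   coordinate of [y] is zero, there is a first [i] with [sin^2 y_i < 1/2], and
   there [dH/dy_i] is bounded away from [0]: points with a zero coordinate are
   not stationary.  Each summand involves two neighbouring coordinates and has
   bounded derivatives, so the derivative tensors are banded and their operator
   norms are bounded independently of [d].  As [m - 1 > q], all derivatives of
   order at most [q] along [y_i] vanish when [y_j = 0] for all [j >= i - 1].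

   The oracle multiplies the slices of index [i] beyond the last nonzero
   coordinate by [z / rho], [z] being a Bernoulli variable of parameter [rho].
   A query then enlarges the support of a zero-respecting algorithm by at most
   one coordinate, and only if [z = 1], so [d] successes are needed; by Markov's
   inequality they have not occurred within [d / (2 rho)] queries with
   probability at least [1/2].  The noise has [p]-th moment of order
   [rho^(1-p)], which dictates [rho] of order [(eps / sigma_1)^(p/(p-1))]. *)
From HB Require Import structures.
From mathcomp Require Import all_boot all_order all_algebra.
From mathcomp Require Import all_classical all_reals all_analysis.
From mathcomp Require Import measurable_realfun ring lra zify.
Require Import Defs.
Set Implicit Arguments.
Unset Strict Implicit.
Unset Printing Implicit Defensive.
Import Order.TTheory GRing.Theory Num.Theory.
Import numFieldNormedType.Exports.
Local Open Scope classical_set_scope.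
Local Open Scope ring_scope.

(** * Trigonometric polynomials *)

Section TrigPolynomials.
Context (R : realType).
Implicit Types (p : {poly R}) (pq : {poly R} * {poly R}) (k n : nat) (x y : R).

(* [p(sin x) + cos x q(sin x)]: a class of bounded functions closed under
   differentiation. *)
Definition trig pq x : R := pq.1.[sin x] + cos x * pq.2.[sin x].

(** Differentiation on coefficient pairs, with [cos x ^+ 2] rewritten as [1 - sin x ^+ 2]. *)
Definition dtrig pq : {poly R} * {poly R} :=
  ((1 - 'X ^+ 2) * pq.2^`() - 'X * pq.2, pq.1^`()).

(** The [k]-th derivative of [p(sin x)]. *)
Definition tower p k : R -> R := trig (iter k dtrig (p, 0)).

Lemma is_derive_trig pq x : is_derive x 1 (trig pq) (trig (dtrig pq) x).
Proof.
have -> : trig pq = (horner pq.1 \o sin) + cos * (horner pq.2 \o sin).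
  by apply/funext => y; rewrite fctE.
have h r := is_derive1_comp (is_derive_poly r (sin x)) (is_derive_sin x).
apply: is_derive_eq (is_deriveD (h _) (is_deriveM (is_derive_cos x) (h _))) _.
rewrite /trig /dtrig !hornerE /GRing.scale /= -cos2sin2; ring.
Qed.

Lemma is_derive_tower p k x : is_derive x 1 (tower p k) (tower p k.+1 x).
Proof. exact: is_derive_trig. Qed.

Lemma tower_continuous p k : continuous (tower p k).
Proof.
move=> x; apply/differentiable_continuous/derivable1_diffP.
by case: (is_derive_tower p k x).
Qed.

Lemma trig_bounded pq : exists2 C, 0 <= C & forall x, `|trig pq x| <= C.
Proof.
have bound p x : `|p.[sin x]| <= \sum_(i < size p) `|p`_i|.
  rewrite horner_coef; apply: le_trans (ler_norm_sum _ _ _) _.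
  apply: ler_sum => i _; rewrite normrM normrX ler_piMr ?exprn_ile1 //.
  by rewrite ler_norml sin_geN1 sin_le1.
exists (\sum_(i < size pq.1) `|pq.1`_i| + \sum_(i < size pq.2) `|pq.2`_i|).
  by rewrite addr_ge0 ?sumr_ge0.
move=> x; apply: le_trans (ler_normD _ _) _; apply: lerD => //.
rewrite normrM; apply: le_trans (bound pq.2 x).
by rewrite ler_piMl // ler_norml cos_geN1 cos_le1.
Qed.

Lemma tower_bounded p n : exists2 C, 0 <= C &
  forall k, (k <= n)%N -> forall x, `|tower p k x| <= C.
Proof.
elim: n => [|n [C C0 hC]].
  have [C C0 hC] := trig_bounded (p, 0); exists C => // k.
  by rewrite leqn0 => /eqP -> x; apply: hC.
have [D D0 hD] := trig_bounded (iter n.+1 dtrig (p, 0)).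
exists (C + D); first exact: addr_ge0.
move=> k; rewrite leq_eqVlt => /predU1P[-> x|/hC {}hC x].
  by apply: le_trans (hD x) _; rewrite lerDr.
by apply: le_trans (hC x) _; rewrite lerDl.
Qed.

Lemma tower_lipschitz p k C : (forall x, `|tower p k.+1 x| <= C) ->
  forall x y, `|tower p k x - tower p k y| <= C * `|x - y|.
Proof.
move=> hC; suff hlt x y : x < y ->
    `|tower p k x - tower p k y| <= C * `|x - y|.
  move=> x y; have [xy|yx|->] := ltgtP x y; first exact: hlt.
    by rewrite distrC [`|x - y|]distrC hlt.
  by rewrite !subrr normr0 mulr0.
move=> xy; rewrite distrC [`|x - y|]distrC.
have [z _ ->] := MVT xy (fun z _ => is_derive_tower p k z)
  (continuous_subspaceT (@tower_continuous p k)).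
by rewrite normrM ler_wpM2r.
Qed.

(* Each [dtrig] lowers the multiplicity of the root [0] of both components by
   at most one. *)
Lemma tower_root0 p n k : dvdp 'X^n p -> (k < n)%N -> tower p k 0 = 0.
Proof.
have dvdXn_deriv (r : {poly R}) l : (dvdp 'X^(l.+1) r -> dvdp 'X^l r^`())%R.
  case/dvdpP => s ->; rewrite derivM derivXn /= -mulr_natr.
  by rewrite dvdp_add // dvdp_mull ?dvdp_exp2l ?dvdp_mulr.
have iterXn l i : dvdp 'X^(i + l) p -> dvdp 'X^l (iter i dtrig (p, 0)).1 /\
    dvdp 'X^l (iter i dtrig (p, 0)).2.
  elim: i l => [|i IH] l /=; first by rewrite dvdp0.
  rewrite addSnnS => /IH[h1 h2]; split; last exact: dvdXn_deriv.
  apply: dvdp_add; first by rewrite dvdp_mull ?dvdXn_deriv.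
  by rewrite dvdpNr; apply: dvdp_trans (dvdp_mull _ h2); apply: dvdp_exp2l.
move=> hp kn; have [] := iterXn (n - k)%N k; first by rewrite subnKC // ltnW.
(* Since [k < n], a factor ['X] survives in both components, and [sin 0 = 0]. *)
rewrite -subn_gt0 in kn; case: (n - k)%N kn => // l _.
rewrite /tower /trig sin0 cos0 => /dvdpP[r ->] /dvdpP[s ->].
by rewrite !hornerM !hornerXn expr0n !mulr0 addr0.
Qed.

End TrigPolynomials.

(** * Partial derivatives of chain functions *)

Lemma is_derive_comp_scalar (R : realType) (V : normedModType R) (g : R -> R)
    (f : V -> R) (x v : V) (dg df : R) :
  differentiable f x -> is_derive (f x) 1 g dg -> is_derive x v f df ->
  is_derive x v (g \o f) (dg * df).
Proof.
move=> dfx [/derivable1_diffP gd <-] [_ <-]; have dgf := differentiable_comp dfx gd.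
apply: DeriveDef; first exact: diff_derivable.
rewrite !deriveE // diff_comp //=.
by rewrite -{1}[X in 'd g _ X]mulr1 -[_ * 1]/(_ *: 1) linearZ mulrC.
Qed.

Section ChainFunction.
Context (R : realType) (pU : nat -> {poly R}) (pV pW : {poly R}).
Context (alpha mu : R) (d : nat).
Implicit Types (x : 'rV[R]_d) (y : nat -> R) (s : seq nat) (a n : nat).

(* Entries of index [n >= d] are [0]. *)
Definition entry x n : R := oapp (x 0) 0 (insub n : option 'I_d).

(** The derivative along [s] of [U_a(y_a) + V(y_a) W(y_(a+1))], where [U_a], [V], [W] are the given
    polynomials composed with [sin]: a summand dies once [s] contains an index foreign to it, and
    each factor is differentiated once per occurrence of its index. *)
Definition block a s y : R :=
  (all (pred1 a) s)%:R * tower (pU a) (size s) (y a) +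
  (all (pred2 a a.+1) s)%:R *
    (tower pV (count_mem a s) (y a) * tower pW (count_mem a.+1 s) (y a.+1)).

(* [chain [::]] is a sum of functions of one and of two neighbouring variables;
   [chain s] is the closed form of its partial derivative along [s] (see
   [partials_chain]). *)
Definition chain s x : R :=
  alpha * mu ^+ size s * \sum_(a < d) block a s (fun n => mu * entry x n).

Lemma entry_ord x (i : 'I_d) : entry x i = x 0 i.
Proof. by rewrite /entry valK. Qed.

Lemma differentiable_entry n x : differentiable (entry^~ n) x.
Proof.
rewrite /entry; case: insubP => [i _ _|_] /=; first exact: differentiable_coord.
exact: differentiable_cst.
Qed.

Lemma is_derive_entry n x (j : 'I_d) :
  is_derive x (delta_mx 0 j : 'rV_d) (entry^~ n) (n == j)%:R.
Proof.
apply: DeriveDef; first exact/diff_derivable/differentiable_entry.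
rewrite /entry; case: insubP => [i _ <-|] /=; last first.
  by case: eqP => [->|]; rewrite ?ltn_ord // derive_cst.
rewrite deriveE; last exact: differentiable_coord.
(* Packing the coordinate map as a linear map makes [diff_lin] applicable. *)
have @f : {linear 'rV[R]_d -> R}.
  by exists (fun N : 'rV[R]_d => N 0 i); do 2![eexists]; do ?[constructor];
    rewrite ?mxE // => ? *; rewrite ?mxE //; move=> ?; rewrite !mxE.
have f_cont : continuous f by exact: coord_continuous.
by rewrite (_ : (fun z : 'rV[R]_d => z 0 i) = f) // diff_lin //= mxE eqxx.
Qed.

Lemma differentiable_tower_entry p k n x :
  differentiable (fun x => tower p k (mu * entry x n)) x.
Proof.
apply: (@differentiable_comp _ _ _ _ (fun x => mu * entry x n)).
  apply: differentiableM; first exact: differentiable_cst.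
  exact: differentiable_entry.
by apply/derivable1_diffP; case: (is_derive_tower p k (mu * entry x n)).
Qed.

Lemma is_derive_tower_entry p k n x (j : 'I_d) :
  is_derive x (delta_mx 0 j : 'rV_d) (fun x => tower p k (mu * entry x n))
    (mu * (n == j)%:R * tower p k.+1 (mu * entry x n)).
Proof.
rewrite mulrC.
apply: (@is_derive_comp_scalar _ _ _ (fun x => mu * entry x n)).
- apply: differentiableM; first exact: differentiable_cst.
  exact: differentiable_entry.
- exact: is_derive_tower.
- have := is_deriveZ mu (is_derive_entry n x j).
  by rewrite /GRing.scale.
Qed.

(** Pointwise operations on functions are the form to which the differentiation rules apply. *)
Lemma chain_fctE s : chain s = (alpha * mu ^+ size s) \*: \sum_(a < d)
    ((all (pred1 (a : nat)) s)%:R \*: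
       (fun x => tower (pU a) (size s) (mu * entry x a)) +
     (all (pred2 (a : nat) a.+1) s)%:R \*:
       ((fun x => tower pV (count_mem (a : nat) s) (mu * entry x a)) *
        (fun x => tower pW (count_mem a.+1 s) (mu * entry x a.+1)))).
Proof. by apply/funext => z; rewrite /chain /= fct_sumE. Qed.

Lemma differentiable_chain s x : differentiable (chain s) x.
Proof.
rewrite chain_fctE; apply: differentiableZ; apply: differentiable_sum => a.
apply: differentiableD; apply: differentiableZ.
  exact: differentiable_tower_entry.
apply: differentiableM; exact: differentiable_tower_entry.
Qed.

Lemma is_derive_chain s x (j : 'I_d) :
  is_derive x (delta_mx 0 j : 'rV_d) (chain s) (chain (val j :: s) x).
Proof.
rewrite chain_fctE.
have hU (a : 'I_d) := is_deriveZ (all (pred1 (a : nat)) s)%:R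
  (is_derive_tower_entry (pU a) (size s) a x j).
have hV (a : 'I_d) := is_deriveZ (all (pred2 (a : nat) a.+1) s)%:R (is_deriveM
  (is_derive_tower_entry pV (count_mem (a : nat) s) a x j)
  (is_derive_tower_entry pW (count_mem a.+1 s) a.+1 x j)).
have hS := is_derive_sum (fun a : 'I_d => is_deriveD (hU a) (hV a)).
apply: is_derive_eq (is_deriveZ (alpha * mu ^+ size s) hS) _.
rewrite /chain /GRing.scale /= exprSr !mulrA -mulrA; congr (_ * _).
rewrite mulr_sumr; apply: eq_bigr => a _.
rewrite /block /= ![(j : nat) == _]eq_sym.
(* The variable [j] is the first of block [j] or the second of block [j - 1], so within one block at
   most one term of the product rule survives. *)
have [->|aj] := eqVneq (a : nat) j; last first.
  by case: eqP => _; rewrite /= ?add0n ?add1n ?addn0; ring.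
have -> : (j.+1 == j) = false by apply/eqP; lia.
by rewrite /= ?add0n ?add1n ?addn0; ring.
Qed.

Lemma partials_chain (s : seq 'I_d) :
  partials (chain [::]) s = chain (map val s).
Proof.
elim: s => [//|j s IH]; rewrite /partials /= -/(partials _ _) IH.
by apply/funext => x; have [_ ->] := is_derive_chain (map val s) x j.
Qed.

Lemma chain_times_differentiable q : times_differentiable q (chain [::]).
Proof. by move=> s _ x; rewrite partials_chain; exact: differentiable_chain. Qed.

End ChainFunction.

(** * Operator norms of banded tensors *)

Section EuclideanNorm.
Context (R : realType) (d : nat).
Implicit Types (v w : 'rV[R]_d).

Lemma enorm_ge0 v : 0 <= enorm v.
Proof. exact: sqrtr_ge0. Qed.

Lemma enorm_sqr v : enorm v ^+ 2 = \sum_(i < d) v 0 i ^+ 2.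
Proof. by rewrite sqr_sqrtr // sumr_ge0 // => i _; exact: sqr_ge0. Qed.

Lemma enorm0 : enorm (0 : 'rV[R]_d) = 0.
Proof. by rewrite /enorm big1 ?sqrtr0 // => i _; rewrite mxE expr0n. Qed.

Lemma norm_entry_le_enorm v i : `|v 0 i| <= enorm v.
Proof.
rewrite -(@ler_pXn2r _ 2) ?nnegrE ?enorm_ge0 // enorm_sqr real_normK ?num_real //.
by rewrite (bigD1 i) //= lerDl sumr_ge0 // => j _; exact: sqr_ge0.
Qed.

End EuclideanNorm.

Section BandedTensors.
Context (R : realType) (d : nat).
Implicit Types (v w : 'rV[R]_d) (a : nat).

(** The mass that [v] puts on the two variables of block [a]; for [a = d - 1] the second entry is
    the conventional [0]. *)
Definition window v a : R := `|entry v a| + `|entry v a.+1|.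

Lemma window_ge0 v a : 0 <= window v a.
Proof. exact: addr_ge0. Qed.

Lemma entry_sum v a : `|entry v a| = \sum_(i < d | i == a :> nat) `|v 0 i|.
Proof.
rewrite /entry; case: insubP => [i _ <-|ad] /=; first by rewrite big_pred1_eq.
by rewrite normr0 big1 // => i /eqP ia; rewrite -ia ltn_ord in ad.
Qed.

Lemma window_sum v a : window v a = \sum_(i < d | pred2 a a.+1 i) `|v 0 i|.
Proof.
rewrite /window !entry_sum [RHS](bigID (fun i : 'I_d => i == a :> nat)) /=.
by congr (_ + _); apply: eq_bigl => i /=; [rewrite orbK | apply/idP/idP; lia].
Qed.

Lemma norm_entryn_le_enorm v a : `|entry v a| <= enorm v.
Proof.
rewrite /entry; case: insubP => [i _ _|_] /=; first exact: norm_entry_le_enorm.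
by rewrite normr0 enorm_ge0.
Qed.

Lemma window_le v a : window v a <= 2 * enorm v.
Proof. by rewrite mulr_natl mulr2n lerD // norm_entryn_le_enorm. Qed.

(** Each coordinate lies in at most two windows, and squaring a sum of two terms costs another
    factor [2]. *)
Lemma sum_window_sqr v : \sum_(a < d) window v a ^+ 2 <= 4 * enorm v ^+ 2.
Proof.
have S0 : \sum_(a < d) entry v a ^+ 2 = enorm v ^+ 2.
  by rewrite enorm_sqr; apply: eq_bigr => i _; rewrite entry_ord.
have S1 : \sum_(a < d) entry v a.+1 ^+ 2 <= enorm v ^+ 2.
  (* The shifted sum arises by splitting off the first or the last of [d.+1] terms; the last one is
     [0]. *)
  have Sr := @big_ord_recr R 0 +%R d (fun a : 'I_d.+1 => entry v a ^+ 2).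
  have Sl := @big_ord_recl R 0 +%R d (fun a : 'I_d.+1 => entry v a ^+ 2).
  have vd : entry v d = 0 by rewrite /entry insubF ?ltnn.
  rewrite Sl /= S0 vd expr0n addr0 in Sr.
  by rewrite -Sr lerDr sqr_ge0.
apply: (@le_trans _ _ (\sum_(a < d) 2 * (entry v a ^+ 2 + entry v a.+1 ^+ 2))).
  apply: ler_sum => a _; rewrite -[entry v a ^+ 2]real_normK ?num_real //.
  rewrite -[entry v a.+1 ^+ 2]real_normK ?num_real // /window.
  by have := sqr_ge0 (`|entry v a| - `|entry v a.+1|); nra.
rewrite -mulr_sumr big_split /= S0; lra.
Qed.

(* AM-GM with the weight [enorm w] replaces Cauchy-Schwarz. *)
Lemma sum_window_mul w v : enorm v <= 1 ->
  \sum_(a < d) window w a * window v a <= 4 * enorm w.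
Proof.
move=> v1; have [w0|wn0] := eqVneq (enorm w) 0.
  rewrite w0 mulr0 big1 // => a _.
  have : window w a <= 0 by rewrite (le_trans (window_le w a)) // w0 mulr0.
  by have := window_ge0 w a => ? ?; rewrite (_ : window w a = 0) ?mul0r //; lra.
have wp : 0 < enorm w by rewrite lt_def wn0 enorm_ge0.
have Sw := sum_window_sqr w; have Sv := sum_window_sqr v.
(* After multiplication by [enorm w], each of the two sums of squares contributes at most
   [2 * enorm w ^+ 2]. *)
rewrite -(ler_pM2l wp).
apply: (@le_trans _ _ (2^-1 * \sum_(a < d) window w a ^+ 2 +
    2^-1 * enorm w ^+ 2 * \sum_(a < d) window v a ^+ 2)).
  rewrite !mulr_sumr -big_split /=; apply: ler_sum => a _.
  by have := sqr_ge0 (window w a - enorm w * window v a); nra.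
have v2 : enorm v ^+ 2 <= 1 by rewrite expr_le1 ?enorm_ge0.
have : enorm w ^+ 2 * \sum_(a < d) window v a ^+ 2 <= enorm w ^+ 2 * 4.
  by rewrite ler_wpM2l ?sqr_ge0 //; lra.
rewrite -mulrA; nra.
Qed.

Lemma sum_tuple_prod k (g : 'I_k -> 'I_d -> R) :
  \sum_(t : k.-tuple 'I_d) \prod_(j < k) g j (tnth t j) =
  \prod_(j < k) \sum_(i < d) g j i.
Proof.
rewrite bigA_distr_bigA /=.
rewrite (reindex (fun f : {ffun 'I_k -> 'I_d} => [tuple f j | j < k])) /=.
  by apply: eq_bigr => f _; apply: eq_bigr => j _; rewrite tnth_mktuple.
exists (fun t : k.-tuple 'I_d => [ffun j => tnth t j]) => [f _|t _].
  by apply/ffunP => j; rewrite ffunE tnth_mktuple.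
by apply/eq_from_tnth => j; rewrite tnth_mktuple ffunE.
Qed.

(** [T] is dominated by a sum of tensors constant on the cubes [{a, a+1}^k], and on absolute values
    each of these evaluates to a product of window masses, by [sum_tuple_prod]. *)
Lemma tapply_banded k (T : tensor R d k) (c : 'I_d -> R) (v : 'I_k -> 'rV[R]_d) :
  (forall t, `|T t| <= \sum_(a < d) (all (pred2 (a : nat) a.+1) (map val t))%:R * c a) ->
  `|tapply T v| <= \sum_(a < d) c a * \prod_(j < k) window (v j) a.
Proof.
move=> hT; apply: le_trans (ler_norm_sum _ _ _) _.
under [leRHS]eq_bigr => a _.
  rewrite (eq_bigr (fun j => \sum_(i < d) (pred2 (a : nat) a.+1 i)%:R * `|v j 0 i|)).
    rewrite -(sum_tuple_prod (fun j i => (pred2 (a : nat) a.+1 i)%:R * `|v j 0 i|)).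
    rewrite mulr_sumr.
    over.
  move=> j _; rewrite window_sum big_mkcond /=; apply: eq_bigr => i _.
  by case: ifP; rewrite ?mul1r ?mul0r.
rewrite exchange_big /=; apply: ler_sum => t _.
rewrite normrM normr_prod.
have -> : \sum_(a < d) c a * \prod_(j < k)
    ((pred2 (a : nat) a.+1 (tnth t j))%:R * `|v j 0 (tnth t j)|) =
    (\sum_(a < d) (all (pred2 (a : nat) a.+1) (map val t))%:R * c a) *
    \prod_(j < k) `|v j 0 (tnth t j)|.
  rewrite mulr_suml; apply: eq_bigr => a _.
  rewrite big_split /= mulrA; congr (_ * _); rewrite mulrC; congr (_ * _).
  rewrite all_map; case: allP => [h|h].
    by rewrite big1 // => j _; move: (h _ (mem_tnth j t)) => /= ->.
  apply/eqP; rewrite prodf_seq_eq0; apply/negPn/negP => /hasPn h'; apply: h => i.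
  case/tnthP => j ->; have := h' j (mem_index_enum j).
  by rewrite /= pnatr_eq0 eqb0 negbK.
by rewrite ler_wpM2r // prodr_ge0.
Qed.

Lemma opnorm_le k (T : tensor R d k) (B : R) :
  (forall v : 'I_k -> 'rV[R]_d,
    (forall j, enorm (v j) <= 1) -> `|tapply T v| <= B) ->
  opnorm T <= B.
Proof.
move=> hB; apply: ge_sup.
  exists `|tapply T (fun _ => 0)|, (fun _ => 0) => // j.
  by rewrite /= enorm0.
by move=> _ [v hv <-]; exact: hB.
Qed.

Lemma opnorm_ge0 k (T : tensor R d k) : 0 <= opnorm T.
Proof.
rewrite /opnorm; set S := [set _ | _ in _].
(* [sup] is [0] by default on a set without supremum. *)
have [hS|/sup_out->//] := pselect (has_sup S).
have [z Sz] := hS.1; apply: le_trans (ub_le_sup hS.2 Sz).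
by case: Sz => v _ <-.
Qed.

End BandedTensors.

(** * Bounds on the derivative tensors of chain functions, uniform in the dimension *)

Section ChainBounds.
Context (R : realType) (pU : nat -> {poly R}) (pV pW : {poly R}).
Context (alpha mu C : R) (d q : nat).
Context (alpha_ge0 : 0 <= alpha) (mu_ge0 : 0 <= mu).
Context (towerU : forall a k x, (k <= q.+1)%N -> `|tower (pU a) k x| <= C).
Context (towerV : forall k x, (k <= q.+1)%N -> `|tower pV k x| <= C).
Context (towerW : forall k x, (k <= q.+1)%N -> `|tower pW k x| <= C).
Implicit Types (x y : 'rV[R]_d) (s : seq nat) (a : nat).

Let K := C + C ^+ 2.
Let F := @chain R pU pV pW alpha mu d [::].

Let C_ge0 : 0 <= C.
Proof. exact: le_trans (normr_ge0 _) (towerV 0 (leq0n _)). Qed.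

Let K_ge0 : 0 <= K.
Proof. by rewrite addr_ge0 ?sqr_ge0. Qed.

Lemma block_bounded a s u : (size s <= q.+1)%N ->
  `|block pU pV pW a s u| <= (all (pred2 a a.+1) s)%:R * K.
Proof.
move=> sq; have cs p : (count p s <= q.+1)%N := leq_trans (count_size p s) sq.
rewrite /block; case: (boolP (all (pred2 a a.+1) s)) => h; last first.
  rewrite (_ : all (pred1 a) s = false) ?mul0r ?addr0 ?normr0 //.
  by apply: contraNF h; apply: sub_all => j /= ->.
rewrite !mul1r; apply: le_trans (ler_normD _ _) _; apply: lerD.
  rewrite normrM; apply: le_trans (towerU a (u a) sq).
  by rewrite ler_piMl // normr_nat lern1 leq_b1.
by rewrite normrM expr2 ler_pM // ?towerV ?towerW.
Qed.

(** A bound on the towers up to order [q.+1] is a Lipschitz constant up to order [q]; in the product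
    one factor is changed at a time. *)
Lemma block_lipschitz a s u w : (size s <= q)%N ->
  `|block pU pV pW a s u - block pU pV pW a s w| <=
  (all (pred2 a a.+1) s)%:R * (K * (`|u a - w a| + `|u a.+1 - w a.+1|)).
Proof.
move=> sq; have cs p : (count p s <= q)%N := leq_trans (count_size p s) sq.
rewrite /block; case: (boolP (all (pred2 a a.+1) s)) => h; last first.
  rewrite (_ : all (pred1 a) s = false) ?mul0r ?addr0 ?subrr ?normr0 //.
  by apply: contraNF h; apply: sub_all => j /= ->.
rewrite !mul1r.
have lipU := @tower_lipschitz _ (pU a) (size s) C
  (fun z => towerU a z (leq_ltn_trans sq (ltnSn q))) (u a) (w a).
have lipV := @tower_lipschitz _ pV (count_mem a s) C
  (fun z => towerV z (leq_ltn_trans (cs _) (ltnSn q))) (u a) (w a).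
have lipW := @tower_lipschitz _ pW (count_mem a.+1 s) C
  (fun z => towerW z (leq_ltn_trans (cs _) (ltnSn q))) (u a.+1) (w a.+1).
have bV := towerV (w a) (leqW (cs (pred1 a))).
have bW := towerW (u a.+1) (leqW (cs (pred1 a.+1))).
move: lipU lipV lipW bV bW.
set U1 := tower _ _ _; set U2 := tower _ _ _; set V1 := tower _ _ _.
set V2 := tower _ _ _; set W1 := tower _ _ _; set W2 := tower _ _ _.
set b := (all _ _)%:R => lipU lipV lipW bV bW.
have b1 : `|b| <= 1 by rewrite normr_nat lern1 leq_b1.
rewrite (_ : _ - _ = b * (U1 - U2) + ((V1 - V2) * W1 + V2 * (W1 - W2))); last by ring.
have hU : `|b * (U1 - U2)| <= C * `|u a - w a|.
  by rewrite normrM; apply: le_trans lipU; rewrite ler_piMl.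
have hV : `|(V1 - V2) * W1| <= (C * `|u a - w a|) * C by rewrite normrM ler_pM.
have hW : `|V2 * (W1 - W2)| <= C * (C * `|u a.+1 - w a.+1|).
  by rewrite normrM ler_pM.
apply: le_trans (ler_normD _ _) _.
have hVW := ler_normD ((V1 - V2) * W1) (V2 * (W1 - W2)).
have hC : 0 <= C * `|u a.+1 - w a.+1| by rewrite mulr_ge0.
by rewrite /K; nra.
Qed.

(** Only the bands [a = i] and [a = i - 1] contain [i], and each window of a unit vector is at most
    [2]; hence a bound independent of [d]. *)
Lemma banded_slice_opnorm k (T : tensor R d k.+1) (i : 'I_d) (c : R) :
  0 <= c ->
  (forall t, `|T t| <= \sum_(a < d) (all (pred2 (a : nat) a.+1) (map val t))%:R *
                                   ((pred2 (a : nat) a.+1 i)%:R * c)) ->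
  opnorm T <= c * 2 ^+ k.+2.
Proof.
move=> c0 hT; apply: opnorm_le => v hv; apply: le_trans (tapply_banded _ hT) _.
have win a j : window (v j) a <= 2.
  by apply: le_trans (window_le _ _) _; rewrite ler_piMr // hv.
apply: (@le_trans _ _ (\sum_(a < d) (pred2 (a : nat) a.+1 i)%:R * (c * 2 ^+ k.+1))).
  apply: ler_sum => a _; rewrite -mulrA ler_wpM2l // ler_wpM2l //.
  rewrite -[k.+1 in leRHS]card_ord -prodr_const.
  by apply: ler_prod => j _; rewrite window_ge0 win.
rewrite -mulr_suml [2 ^+ k.+2]exprS [leRHS]mulrCA ler_wpM2r ?mulr_ge0 ?exprn_ge0 //.
have pred2E (a : 'I_d) : (pred2 (a : nat) a.+1 i)%:R <=
    (a == i)%:R + (a.+1 == i)%:R :> R.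
  rewrite /= ![(i : nat) == _]eq_sym -(inj_eq val_inj) /=.
  by case: eqP; case: eqP => /= _ _; lra.
apply: (@le_trans _ _ (\sum_(a < d) ((a == i)%:R + (a.+1 == i)%:R))).
  by apply: ler_sum => a _; exact: pred2E.
rewrite big_split /=.
have -> : \sum_(a < d) (a == i)%:R = 1 :> R.
  by rewrite (bigD1 i) //= eqxx big1 ?addr0 // => a /negPf ->.
suff : \sum_(a < d) (a.+1 == i)%:R <= 1 :> R by lra.
case: (posnP i) => [i0|ip].
  by rewrite big1 // => a _; rewrite i0.
have pd : (i.-1 < d)%N by rewrite (leq_ltn_trans (leq_pred i)).
rewrite (bigD1 (Ordinal pd)) //= prednK // eqxx big1 ?addr0 // => a.
rewrite -(inj_eq val_inj) /= => h; case: eqP => // e.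
by rewrite -e /= eqxx in h.
Qed.

Lemma chain_entry_bounded (t : seq 'I_d) x : (size t <= q.+1)%N ->
  `|partials F t x| <= \sum_(a < d) (all (pred2 (a : nat) a.+1) (map val t))%:R *
    (alpha * mu ^+ size t * K).
Proof.
move=> tq; rewrite partials_chain /chain size_map normrM.
rewrite ger0_norm ?mulr_ge0 ?exprn_ge0 //.
apply: (@le_trans _ _ (alpha * mu ^+ size t *
    \sum_(a < d) (all (pred2 (a : nat) a.+1) (map val t))%:R * K)).
  rewrite ler_wpM2l ?mulr_ge0 ?exprn_ge0 //.
  apply: le_trans (ler_norm_sum _ _ _) _; apply: ler_sum => a _.
  by apply: block_bounded; rewrite size_map.
by rewrite mulr_sumr; apply: ler_sum => a _; rewrite mulrCA.
Qed.

(** The difference of two blocks is controlled by a window of [x - y]. Pairing it with the window of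
    one argument through [sum_window_mul] gives [4 * enorm (x - y)] without a factor [d]; the other
    [k] windows are at most [2] each. *)
Lemma chain_lipschitz k x y : (k.+1 <= q)%N ->
  opnorm (dtensor F k.+1 x - dtensor F k.+1 y) <=
  alpha * mu ^+ k.+2 * (K * 2 ^+ k.+2) * enorm (x - y).
Proof.
move=> kq; apply: opnorm_le => v hv.
have D0 : 0 <= alpha * mu ^+ k.+2 * K by apply/mulr_ge0/K_ge0/mulr_ge0/exprn_ge0.
pose c (a : 'I_d) := alpha * mu ^+ k.+2 * K * window (x - y) a.
apply: le_trans (@tapply_banded _ _ _ _ c _ _) _ => [t|].
  rewrite -[(_ - _) t]/(partials F t x - partials F t y) !partials_chain /chain.
  rewrite size_map size_tuple -mulrBr -sumrB.
  rewrite normrM ger0_norm ?mulr_ge0 ?exprn_ge0 //.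
  apply: le_trans (ler_wpM2l _ (ler_norm_sum _ _ _)) _.
    by rewrite mulr_ge0 ?exprn_ge0.
  rewrite mulr_sumr; apply: ler_sum => a _.
  apply: le_trans (ler_wpM2l _ (block_lipschitz _ _ _ _)) _.
  - by rewrite mulr_ge0 ?exprn_ge0.
  - by rewrite size_map size_tuple.
  have entryB n : entry x n - entry y n = entry (x - y) n.
    by rewrite /entry; case: insub => [i|] /=; rewrite ?mxE ?subr0.
  rewrite -!mulrBr !entryB !normrM (ger0_norm mu_ge0) /c /window !exprS.
  by rewrite le_eqVlt; apply/orP; left; apply/eqP; ring.
apply: (@le_trans _ _ (\sum_(a < d) alpha * mu ^+ k.+2 * K * 2 ^+ k *
    (window (x - y) a * window (v ord0) a))).
  apply: ler_sum => a _; rewrite big_ord_recl /c.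
  have P2 : \prod_(j < k) window (v (lift ord0 j)) a <= 2 ^+ k.
    rewrite -[X in _ ^+ X]card_ord -prodr_const.
    apply: ler_prod => j _; rewrite window_ge0 /=.
    by apply: le_trans (window_le _ _) _; rewrite ler_piMr // hv.
  have h0 : 0 <= alpha * mu ^+ k.+2 * K * (window (x - y) a * window (v ord0) a).
    by rewrite mulr_ge0 // mulr_ge0 ?window_ge0.
  apply: le_trans (le_trans _ (ler_wpM2l h0 P2)) _;
    by rewrite le_eqVlt; apply/orP; left; apply/eqP; ring.
rewrite -mulr_sumr.
apply: le_trans (ler_wpM2l _ (sum_window_mul _ (hv ord0))) _.
  by rewrite mulr_ge0 ?exprn_ge0.
by rewrite le_eqVlt; apply/orP; left; apply/eqP; rewrite !exprS; ring.
Qed.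

End ChainBounds.

(** * The hard function *)

Section HardFunction.
Context (R : realType) (q : nat).
Let m := (q.+1).*2.

(* The summand [- m sin^(m-1)] dominates the negative part of the derivative of
   [- sin^m y_a sin y_(a+1)], and makes all partial derivatives sign-definite. *)
Definition hardU (a : nat) : {poly R} := - (m%:R *: 'X^(m.-1)) - (a == 0)%:R *: 'X.
Definition hardV : {poly R} := - 'X^m.

Lemma tower0 (p : {poly R}) x : tower p 0 x = p.[sin x].
Proof. by rewrite /tower /trig /= horner0 mulr0 addr0. Qed.

Lemma tower1 (p : {poly R}) x : tower p 1 x = cos x * p^`().[sin x].
Proof. by rewrite /tower /trig /= !hornerE deriv0 horner0 !mulr0 subr0 add0r. Qed.

Lemma tower_X1 x : tower ('X : {poly R}) 1 x = cos x.
Proof. by rewrite tower1 derivX hornerE mulr1. Qed.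

(** [hardU a] depends on [a] only through [a == 0], so only four polynomials have to be bounded. *)
Lemma hard_tower_bounded : exists2 C : R, 0 <= C & [/\
  forall a k x, (k <= q.+1)%N -> `|tower (hardU a) k x| <= C,
  forall k x, (k <= q.+1)%N -> `|tower hardV k x| <= C &
  forall k x, (k <= q.+1)%N -> `|tower ('X : {poly R}) k x| <= C].
Proof.
have [C0 C0p h0] := tower_bounded (hardU 0) q.+1.
have [C1 C1p h1] := tower_bounded (hardU 1) q.+1.
have [C2 C2p h2] := tower_bounded hardV q.+1.
have [C3 C3p h3] := tower_bounded ('X : {poly R}) q.+1.
exists (C0 + C1 + C2 + C3); first by rewrite !addr_ge0.
split=> [[|a]|k|k] *;
  [have := h0 _ _ _|have := h1 _ _ _|have := h2 _ _ _|have := h3 _ _ _];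
  by move=> h; apply: le_trans (h _ _ _) _; [eassumption|lra].
Qed.

Lemma deriv_hardU a z :
  (hardU a)^`().[z] = - (m%:R * (m.-1%:R * z ^+ q.*2)) - (a == 0)%:R.
Proof.
rewrite /hardU derivB derivN !derivZ derivX derivXn !hornerE.
by rewrite hornerMn hornerXn /m doubleS /= -[z ^+ _ *+ _]mulr_natl mulrA.
Qed.

Lemma deriv_hardV z : hardV^`().[z] = - (m%:R * (z ^+ q.*2 * z)).
Proof.
rewrite /hardV derivN derivXn hornerN hornerMn hornerXn mulr_natl.
by rewrite -exprSr /m doubleS.
Qed.

Context (alpha mu : R) (d : nat).
Implicit Types (x : 'rV[R]_d) (i : 'I_d).

Definition hard : 'rV[R]_d -> R := chain hardU hardV 'X alpha mu [::].

(** A block depending on coordinate [i] has index [i] or [i - 1], so its first variable is [0].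
    There [hardV] and, as [0 < i] removes the linear term, [hardU i] give functions with a zero of
    order at least [m - 1 > q]. *)
Lemma hard_slice0 x i (t : seq 'I_d) : (0 < i)%N ->
  (forall j : 'I_d, (i <= j.+1)%N -> x 0 j = 0) -> (size t < q)%N ->
  partials hard (i :: t) x = 0.
Proof.
move=> ip hx tq; rewrite partials_chain /chain [X in _ * X]big1 ?mulr0 // => a _.
have y0 : (i <= a.+1)%N -> mu * entry x a = 0.
  by move=> ia; rewrite entry_ord hx // mulr0.
rewrite /block /=; set s := map val t.
have cs (P : pred nat) : (count P s <= size t)%N by rewrite -(size_map val t) count_size.
have V0 n : (n <= q)%N -> tower hardV n 0 = 0.
  move=> nq; apply: (@tower_root0 _ _ m); last by rewrite /m; lia.
  by rewrite /hardV dvdpNr.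
have U0 n : (n <= q)%N -> tower (hardU i) n 0 = 0.
  move=> nq; apply: (@tower_root0 _ _ m.-1); last by rewrite /m; lia.
  by rewrite /hardU gtn_eqF // scale0r subr0 dvdpNr -mul_polyC dvdp_mull.
rewrite [X in X + _](_ : _ = 0) ?add0r.
  case: (boolP (_ && _)) => [/andP[/orP[/eqP ia|/eqP ia] _]|_]; rewrite ?mul0r //.
    rewrite y0 -?ia ?leqnn // V0 ?mul0r ?mulr0 //.
    by rewrite eqxx add1n (leq_trans _ tq) // ltnS cs.
  rewrite y0 ?ia // V0 ?mul0r ?mulr0 //.
  rewrite (_ : (_ == _) = false) ?add0n; last by apply/eqP; lia.
  by rewrite ltnW // (leq_ltn_trans (cs _)).
case: (boolP (_ && _)) => [/andP[/eqP ia _]|_]; rewrite ?mul0r //.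
by rewrite y0 -?ia // U0 ?mulr0 // size_map.
Qed.

(** The first summand comes from block [i], and [s j ^+ m] from block [i - 1]; at [i = 0] the
    summand [- sin y_0] yields [1] instead. *)
Lemma hard_partial1 x i : let s n := sin (mu * entry x n) in
  partials hard [:: i] x = - (alpha * mu) * cos (mu * entry x i) *
    (m%:R * s i ^+ (q.*2) * (m.-1%:R + s i * s i.+1)
     + if val i is j.+1 then s j ^+ m else 1).
Proof.
move=> s; rewrite partials_chain /chain expr1.
have blockE (a : 'I_d) : block hardU hardV 'X a [:: val i] (fun n => mu * entry x n) =
  (if a == i :> nat then - cos (mu * entry x i) *
     (m%:R * s i ^+ (q.*2) * (m.-1%:R + s i * s i.+1) + (i == 0 :> nat)%:R) else 0) +
  (if a.+1 == i :> nat then - cos (mu * entry x i) * s a ^+ m else 0).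
  rewrite /block /= !andbT !addn0 ![nat_of_ord i == _]eq_sym.
  have [->|ai] := eqVneq (nat_of_ord a) i.
    rewrite (_ : (i.+1 == i :> nat) = false) /=; last by apply/eqP; lia.
    rewrite tower0 !tower1 deriv_hardU deriv_hardV hornerX -/(s i) -/(s i.+1).
    rewrite [0%N == _]eq_sym; move: m%:R m.-1%:R (_ == 0%N)%:R => *; ring.
  have [ai1|ai1] := eqVneq a.+1 (nat_of_ord i).
    rewrite /= mul0r !add0r mul1r tower0 tower_X1 /hardV hornerN hornerXn -ai1.
    by rewrite !mulNr mulrC.
  by rewrite /= !mul0r addr0.
rewrite (eq_bigr _ (fun a _ => blockE a)) big_split /= -!big_mkcond /=.
rewrite (big_pred1 i) //.
rewrite (_ : \sum_(a < d | a.+1 == i) _ = - cos (mu * entry x i) *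
    if val i is j.+1 then s j ^+ m else 0).
  by rewrite /=; case: (nat_of_ord i) => [|j]; rewrite /=; ring.
case: i {blockE} => [[|j] /= ji]; first by rewrite big1 ?mulr0.
by rewrite (big_pred1 (Ordinal (ltnW ji))).
Qed.

(* All terms of [hard_partial1] have the sign of [cos]; hence at the first
   coordinate with [sin ^+ 2 < 2^-1] nothing cancels. *)
Lemma hard_gradient x i : 0 < alpha -> 0 < mu -> x 0 i = 0 ->
  alpha * mu * 2 ^- q.+2 <= enorm (grad hard x).
Proof.
move=> alpha_gt0 mu_gt0 xi0; pose s n := sin (mu * entry x n).
have [j [sj sj1]] : exists j : 'I_d, s j ^+ 2 < 2^-1 /\
    (forall k, val j = k.+1 -> 2^-1 <= s k ^+ 2).
  have ex : exists k, (k < d)%N && (s k ^+ 2 < 2^-1).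
    exists i; rewrite ltn_ord /s entry_ord xi0 mulr0 sin0 expr0n /=; lra.
  case: (ex_minnP ex) => k /andP[kd sk] kmin; exists (Ordinal kd); split=> //= l kl.
  rewrite leNgt; apply/negP => sl; have := kmin l; rewrite sl kl ltnn.
  by rewrite (leq_trans _ kd) ?kl // => /(_ isT).
apply: le_trans (norm_entry_le_enorm _ j).
rewrite mxE hard_partial1 -/(s j) -/(s j.+1).
set B := (X in `|_ * X|).
(* The first summand is nonnegative, since [q.*2] is even and [m.-1 >= 1]; the second is [1] or the
   [q.+1]-st power of a square that is at least [2^-1]. *)
have B_ge : 2 ^- q.+1 <= B.
  rewrite -[leLHS]add0r; apply: lerD.
    rewrite mulr_ge0 // ?mulr_ge0 ?exprn_even_ge0 ?odd_double //.
    have m1 : 1 <= m.-1%:R :> R by rewrite ler1n /m; lia.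
    have sb n : -1 <= s n <= 1 by rewrite sin_geN1 sin_le1.
    by have := sb j; have := sb j.+1; move=> /andP[? ?] /andP[? ?]; nra.
  case: (val j) sj1 => [_|k /(_ k erefl) sk].
    by rewrite -exprVn exprn_ile1 //; lra.
  by rewrite -exprVn /m -mul2n exprM lerXn2r ?nnegrE ?sqr_ge0 //; lra.
have B_ge0 : 0 <= B by apply: le_trans B_ge; rewrite -exprVn exprn_ge0.
rewrite !normrM normrN normrM (gtr0_norm alpha_gt0) (gtr0_norm mu_gt0) (ger0_norm B_ge0).
rewrite -[leRHS]mulrA ler_wpM2l //; first by rewrite mulr_ge0 // ltW.
(* As [cos ^+ 2] exceeds [2^-1], the cosine supplies the last factor of [2 ^- q.+2]. *)
have cos_ge : 2^-1 <= `|cos (mu * entry x j)|.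
  rewrite -(@ler_pXn2r _ 2) ?nnegrE // real_normK ?num_real // cos2sin2.
  by move: sj; rewrite /s => sj; lra.
rewrite -exprVn exprS; apply: ler_pM; rewrite ?exprn_ge0 ?exprVn //.
Qed.

End HardFunction.

(** * The oracle *)

Section Measurability.
Context (R : realType) (d : nat).

Lemma continuous_measurable_rV (f : 'rV[R]_d -> R) : continuous f ->
  measurable_fun setT (f : borel_rV R d -> measurableTypeR R).
Proof.
move=> cf; apply: (measurability _ (RGenOInfty.measurableE R)).
move=> /= _ [_ [a ->]] <-; apply: measurableI => //; apply: sub_sigma_algebra.
by apply: open_comp => [x _|]; [exact: cf | exact: interval_open].
Qed.

Lemma closed_measurable_rV (D : set 'rV[R]_d) : closed D ->
  measurable (D : set (borel_rV R d)).
Proof.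
move=> cD; rewrite -[D]setCK; apply: measurableC; apply: sub_sigma_algebra.
exact: closed_openC.
Qed.

Lemma measurable_to_answer q dT (T : measurableType dT) (f : T -> answer R d q) :
  measurable_fun setT (fun w => (f w).1 : measurableTypeR R) ->
  (forall (k : 'I_q) (t : k.+1.-tuple 'I_d),
     measurable_fun setT (fun w => (f w).2 k t : measurableTypeR R)) ->
  measurable_fun setT (f : T -> measurable_answer R d q).
Proof.
move=> m1 m2; apply: (@measurability _ _ T (measurable_answer R d q) setT f
  (preimage_set_system setT (fun a : answer R d q => a.1)
     (@measurable _ (measurableTypeR R)) `|`
   \bigcup_(k : 'I_q) \bigcup_(t : k.+1.-tuple 'I_d)
     preimage_set_system setT (fun a : answer R d q => a.2 k t)
       (@measurable _ (measurableTypeR R))) erefl).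
move=> _ [_ [[B mB <-]|[k _ [t _ [B mB <-]]]] <-].
  by rewrite !setTI; have := m1 measurableT B mB; rewrite setTI.
by rewrite !setTI; have := m2 k t measurableT B mB; rewrite setTI.
Qed.

End Measurability.

Section Bernoulli.
Context (R : realType) (rho : R) (rho01 : 0 <= rho <= 1).

Lemma integral_bernoulli_EFin (X : bool -> R) :
  (\int[bernoulli_prob rho]_b (X b)%:E)%E =
  (rho * X true + (1 - rho) * X false)%:E.
Proof.
rewrite integralE !integral_bernoulli_prob //.
rewrite !funeposE !funenegE -!EFinN -!EFin_max -!EFinM -!EFinD.
congr EFin; rewrite /unstable.onem.
have maxB z : Num.max z 0 - Num.max (- z) 0 = z :> R.
  rewrite /Num.max oppr_lt0; case: ltgtP => [?|?|->]; lra.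
by rewrite -[X true in RHS]maxB -[X false in RHS]maxB; ring.
Qed.

Lemma bernoulli_has_mean (X : bool -> R) :
  has_mean (bernoulli_prob rho) X (rho * X true + (1 - rho) * X false).
Proof.
split; last by rewrite unlock integral_bernoulli_EFin.
apply/integrableP; split; first by [].
under eq_integral do rewrite /= .
by rewrite (integral_bernoulli_EFin (fun b => `|X b|)) ltry.
Qed.

(* The left-hand side is [E |z / rho - 1| ^ p]. *)
Lemma bernoulli_centered_moment (p : R) : 1 <= p -> 0 < rho ->
  rho * `|rho^-1 - 1| `^ p + (1 - rho) * `|0 - 1| `^ p <= 2 * rho^-1 `^ (p - 1).
Proof.
move=> p1 rho0; have [_ rho1] := andP rho01.
rewrite sub0r normrN1 powR1 mulr1.
have ri1 : 1 <= rho^-1 by rewrite invf_ge1.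
have r1 : 1 <= rho^-1 `^ (p - 1).
  by rewrite -[leLHS](powRr0 rho^-1) ler_powR // subr_ge0.
have rE : rho * rho^-1 `^ p = rho^-1 `^ (p - 1).
  have := @powRD R rho^-1 (p - 1) 1; rewrite subrK invr_eq0 (gt_eqF rho0) implybT.
  move=> ->//; rewrite powRr1 ?invr_ge0 ?(ltW rho0) //.
  by rewrite mulrC mulfVK ?gt_eqF.
(* Success contributes at most [rho^(1-p)], and failure at most [1 <= rho^(1-p)]. *)
have : rho * `|rho^-1 - 1| `^ p <= rho * rho^-1 `^ p.
  rewrite ler_pM2l // ge0_ler_powR ?nnegrE //; try lra.
  by rewrite ger0_norm ?subr_ge0 // gerBl.
rewrite rE; lra.
Qed.

End Bernoulli.

Section HardOracle.
Context (R : realType) (q d : nat) (alpha mu rho : R).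
Local Notation F := (@hard R q alpha mu d).
Implicit Types (x : 'rV[R]_d) (i : 'I_d) (z : bool).

Definition inactive x i : bool :=
  [forall j : 'I_d, (i <= j)%N ==> (x 0 j == 0)].

Lemma inactiveP x i :
  reflect (forall j : 'I_d, (i <= j)%N -> x 0 j = 0) (inactive x i).
Proof.
by apply: (iffP forallP) => h j; have := h j;
  [move/implyP => H /H /eqP | move=> H; apply/implyP => /H ->].
Qed.

(** Beyond the least inactive index the true slices already vanish, so the noise of the oracle sits
    in a single slice. *)
Lemma partials_hard_inactive x i i' (t : seq 'I_d) :
  inactive x i -> (i < i')%N -> (size t < q)%N -> partials F (i' :: t) x = 0.
Proof.
move=> /inactiveP xi ii' tq; apply: hard_slice0 => // [|j ij].
  exact: leq_ltn_trans ii'.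
by apply: xi; rewrite -ltnS (leq_trans ii').
Qed.

Definition hard_respond x z : answer R d q :=
  (F x, fun (k : 'I_q) (t : k.+1.-tuple 'I_d) =>
    (if inactive x (thead t) then z%:R / rho else 1) * dtensor F k.+1 x t).

Lemma partials_hard_continuous (s : seq 'I_d) : continuous (partials F s).
Proof.
by move=> x; rewrite partials_chain; apply/differentiable_continuous/differentiable_chain.
Qed.

Lemma inactive_measurable i :
  measurable_fun setT (inactive^~ i : borel_rV R d -> bool).
Proof.
apply: (measurable_fun_bool true); rewrite setTI; apply: closed_measurable_rV.
rewrite (_ : _ @^-1` _ = \bigcap_(j in [set j : 'I_d | (i <= j)%N])
    (fun x : 'rV[R]_d => x 0 j) @^-1` [set 0]).
  apply: closed_bigI => j _; apply: preimage_closed; last exact: closed_eq.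
  by move=> x _; exact: coord_continuous.
by apply/seteqP; split=> x /=; [move/inactiveP | move=> h; apply/inactiveP].
Qed.

Lemma hard_respond_measurable : measurable_fun setT
  (fun w : borel_rV R d * bool =>
     hard_respond w.1 w.2 : measurable_answer R d q).
Proof.
have contM s : measurable_fun setT
    (fun w : borel_rV R d * bool => partials F s w.1 : measurableTypeR R).
  apply: (measurableT_comp (f := partials F s : borel_rV R d -> measurableTypeR R)) => //.
  apply: continuous_measurable_rV. exact: partials_hard_continuous.
apply: measurable_to_answer => [|k t]; first exact: (contM [::]).
apply: measurable_funM; last exact: contM.
apply: measurable_fun_ifT => //.
- apply: (measurableT_comp (f := inactive^~ (thead t) : borel_rV R d -> bool)) => //.
  exact: inactive_measurable.
- by apply: (measurableT_comp (f := fun z : bool => z%:R / rho)) => //.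
Qed.

Definition hard_oracle : oracle R d q :=
  @Oracle R d q _ bool (bernoulli_prob rho) hard_respond hard_respond_measurable.

(** If [z] fails, the slices from index [n] on are multiplied by [0]; if it succeeds, [hard_slice0]
    still kills those from index [n.+1] on. *)
Lemma asupp_hard_respond x z n : vsupp x `<=` [set i | (i < n)%N] ->
  asupp (hard_respond x z) `<=` [set i | (i < n + z)%N].
Proof.
move=> xn i [k _ /= ki]; rewrite ltnNge; apply/negP => ni; apply: ki.
have x0 (j : 'I_d) : (n <= j)%N -> x 0 j = 0.
  by move=> nj; apply: contrapT => xj; have /= := xn j xj; rewrite ltnNge nj.
apply/funext => t; rewrite /slice /hard_respond (_ : thead _ = i) //=.
case: z ni => [|/[!addn0] ni].
  rewrite addn1 => ni; rewrite [dtensor _ _ _ _](_ : _ = 0) ?mulr0 //.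
  apply: hard_slice0; rewrite ?size_tuple //; first exact: leq_ltn_trans ni.
  by move=> j ij; apply: x0; rewrite -ltnS (leq_trans ni).
rewrite (_ : inactive x i) ?mul0r //.
by apply/inactiveP => j ij; apply: x0; exact: leq_trans ij.
Qed.

Context (rho_gt0 : 0 < rho) (rho_le1 : rho <= 1).

Lemma hard_oracle_for : oracle_for F hard_oracle.
Proof.
have rho01 : 0 <= rho <= 1 by rewrite ltW.
move=> x; split=> [|k t] /=.
  have := bernoulli_has_mean rho01 (fun=> F x).
  by rewrite (_ : _ + _ = F x) //; ring.
have := bernoulli_has_mean rho01 (fun z => (hard_respond x z).2 k t).
rewrite (_ : _ + _ = dtensor F k.+1 x t) // /hard_respond /=.
have rn0 : rho != 0 by rewrite gt_eqF.
by case: ifP => _; field.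
Qed.

(** The noise is [z / rho - 1] times the slice at the least inactive index, to which
    [banded_slice_opnorm] applies. *)
Lemma hard_noise_opnorm (C : R) (x : 'rV[R]_d) z (k : 'I_q) : 0 <= alpha -> 0 <= mu ->
  (forall a k u, (k <= q.+1)%N -> `|tower (@hardU R q a) k u| <= C) ->
  (forall k u, (k <= q.+1)%N -> `|tower (@hardV R q) k u| <= C) ->
  (forall k u, (k <= q.+1)%N -> `|tower ('X : {poly R}) k u| <= C) ->
  opnorm ((hard_respond x z).2 k - dtensor F k.+1 x) <=
  `|z%:R / rho - 1| * (alpha * mu ^+ k.+1 * ((C + C ^+ 2) * 2 ^+ k.+2)).
Proof.
move=> alpha0 mu0 CU CV CW.
have K0 : 0 <= C + C ^+ 2.
  by rewrite addr_ge0 ?sqr_ge0 // (le_trans (normr_ge0 _) (CV 0 0 _)).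
have c0 : 0 <= alpha * mu ^+ k.+1 * (C + C ^+ 2).
  by rewrite mulr_ge0 // mulr_ge0 // exprn_ge0.
set T := _ - _.
have TE t : T t = if inactive x (thead t) then
    (z%:R / rho - 1) * dtensor F k.+1 x t else 0.
  rewrite -[T t]/((hard_respond x z).2 k t - dtensor F k.+1 x t) /hard_respond /=.
  by case: ifP => _; ring.
(* Without an inactive coordinate the answer is exact. *)
have [/existsP[i xi]|/existsPn none] := boolP [exists i, inactive x i]; last first.
  apply: opnorm_le => v _; rewrite /tapply big1 ?normr0 => [|t _].
    by rewrite mulr_ge0 // mulrA mulr_ge0 ?exprn_ge0.
  by rewrite TE (negPf (none _)) mul0r.
case: (arg_minnP (fun i : 'I_d => i : nat) xi) => {xi}i xi imin.
pose c := `|z%:R / rho - 1| * (alpha * mu ^+ k.+1 * (C + C ^+ 2)).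
have cge0 : 0 <= c by rewrite mulr_ge0.
have -> : `|z%:R / rho - 1| * (alpha * mu ^+ k.+1 * ((C + C ^+ 2) * 2 ^+ k.+2)) =
    c * 2 ^+ k.+2 by rewrite /c -!mulrA.
apply: (banded_slice_opnorm (i := i)) => // t; rewrite TE.
have Sge0 : 0 <= \sum_(a < d) (all (pred2 (a : nat) a.+1) (map val t))%:R *
   ((pred2 (a : nat) a.+1 i)%:R * c).
  by apply: sumr_ge0 => a _; rewrite mulr_ge0 // mulr_ge0.
case: ifP => // [xt|_]; last by rewrite normr0.
have := imin _ xt; rewrite leq_eqVlt => /predU1P[it|it]; last first.
  rewrite [X in _ * X](_ : _ = 0) ?mulr0 ?normr0 // /dtensor (tuple_eta t) /=.
  apply: (partials_hard_inactive xi) => //.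
  by rewrite size_behead size_tuple; exact: ltn_ord.
have bt := @chain_entry_bounded R (@hardU R q) (@hardV R q) 'X alpha mu C d q
   alpha0 mu0 CU CV CW t x.
rewrite normrM; apply: le_trans (ler_wpM2l _ (bt _)) _ => //.
  by rewrite size_tuple ltnS ltnW.
rewrite mulr_sumr; apply: ler_sum => a _; rewrite size_tuple.
rewrite mulrCA; case: (boolP (all _ _)) => [h|_]; last by rewrite !mul0r.
have -> : pred2 (a : nat) a.+1 i.
  by rewrite /= it; apply: (allP h); rewrite map_f // mem_tnth.
by rewrite !mul1r.
Qed.

Lemma hard_oracle_in_class (C p : R) (sigma : nat -> R) :
  0 <= alpha -> 0 <= mu -> 1 <= p ->
  (forall a k u, (k <= q.+1)%N -> `|tower (@hardU R q a) k u| <= C) ->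
  (forall k u, (k <= q.+1)%N -> `|tower (@hardV R q) k u| <= C) ->
  (forall k u, (k <= q.+1)%N -> `|tower ('X : {poly R}) k u| <= C) ->
  (forall k, (k < q)%N -> 2 * rho^-1 `^ (p - 1) *
     (alpha * mu ^+ k.+1 * ((C + C ^+ 2) * 2 ^+ k.+2)) `^ p <= sigma k.+1 `^ p) ->
  oracle_class p sigma F hard_oracle.
Proof.
move=> alpha0 mu0 p1 CU CV CW hsigma; split; first exact: hard_oracle_for.
have rho01 : 0 <= rho <= 1 by rewrite ltW.
move=> x k; have meanE := integral_bernoulli_EFin rho01
  (fun z => opnorm ((hard_respond x z).2 k - dtensor F k.+1 x) `^ p).
rewrite unlock [leLHS]meanE lee_fin.
set B := alpha * mu ^+ k.+1 * ((C + C ^+ 2) * 2 ^+ k.+2).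
have K0 : 0 <= C + C ^+ 2.
  by rewrite addr_ge0 ?sqr_ge0 // (le_trans (normr_ge0 _) (CV 0 0 _)).
have B0 : 0 <= B.
  by apply: mulr_ge0; [apply: mulr_ge0|apply: mulr_ge0] => //; apply: exprn_ge0.
have p0 : 0 <= p by lra.
have noise z : opnorm ((hard_respond x z).2 k - dtensor F k.+1 x) `^ p <=
    `|z%:R / rho - 1| `^ p * B `^ p.
  rewrite -powRM // ge0_ler_powR ?nnegrE ?opnorm_ge0 //.
    exact: mulr_ge0.
  exact: hard_noise_opnorm.
apply: le_trans (hsigma _ (ltn_ord k)).
apply: (@le_trans _ _ ((rho * `|rho^-1 - 1| `^ p + (1 - rho) * `|0 - 1| `^ p) * B `^ p)).
  have trueR : (nat_of_bool true)%:R = 1 :> R by [].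
  have falseR : (nat_of_bool false)%:R = 0 :> R by [].
  have := noise true; have := noise false.
  rewrite trueR falseR div1r mul0r => noise0 noise1.
  rewrite [leRHS]mulrDl -!mulrA; apply: lerD.
    by rewrite ler_pM2l.
  by rewrite ler_wpM2l // subr_ge0.
by rewrite ler_wpM2r ?powR_ge0 // bernoulli_centered_moment.
Qed.

End HardOracle.

(** * The query lower bound *)

Section CountingMarkov.
Context dW (W : measurableType dW) (R : realType) (P : probability W R).
Context (A : nat -> set W) (mA : forall i, measurable (A i)).

Lemma measurable_count n (T : R) :
  measurable [set w | T <= \sum_(i < n) \1_(A i) w].
Proof.
have -> : [set w | T <= \sum_(i < n) \1_(A i) w] =
    (fun w => \sum_(i < n) \1_(A i) w : R) @^-1` `[T, +oo[%classic.
  by apply/seteqP; split=> w /=; rewrite in_itv /= andbT.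
rewrite -[X in measurable X]setTI; apply: measurable_sum => // i.
exact: measurable_indic.
Qed.

(** Markov's inequality for the number of events that occur, whose expectation is the sum of their
    probabilities. *)
Lemma count_markov n (T : R) : 0 <= T ->
  (T%:E * P [set w | (T <= \sum_(i < n) \1_(A i) w)%R] <= \sum_(i < n) P (A i))%E.
Proof.
move=> T0; set E := [set w | _]; have mE : measurable E := measurable_count n T.
have -> : (\sum_(i < n) P (A i) = \int[P]_w \sum_(i < n) (\1_(A i) w)%:E)%E.
  rewrite ge0_integral_sum //.
    by apply: eq_bigr => i _; rewrite integral_indic // setIT.
  by move=> i; apply/measurable_EFinP/measurable_indic.
rewrite -[X in P X]setIT -integral_indic // -ge0_integralZl_EFin //; last first.
  exact/measurable_EFinP/measurable_indic.
apply: ge0_le_integral => //.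
- by move=> w _; rewrite mule_ge0.
- by apply: emeasurable_funM => //; apply/measurable_EFinP/measurable_indic.
- by apply: emeasurable_sum => i; apply/measurable_EFinP/measurable_indic.
- move=> w _; rewrite sumEFin -EFinM lee_fin indicE.
  case: (boolP (w \in E)) => [|_]; first by rewrite inE mulr1.
  by rewrite mulr0 sumr_ge0.
Qed.

End CountingMarkov.

(** * Measurability of the queries of an algorithm *)

Section Execution.
Context (R : realType) (d q : nat) (A : algorithm R d q) (O : oracle R d q).

Lemma size_answers (z : seed A) (xi : nat -> sample O) t : size (answers z xi t) = t.
Proof. by elim: t => [//|t IH]; rewrite /= size_rcons IH. Qed.

Lemma nth_answers a0 (z : seed A) (xi : nat -> sample O) t i : (i < t)%N ->
  nth a0 (answers z xi t) i = respond O (query z xi i) (xi i).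
Proof.
elim: t => [//|t IH]; rewrite ltnS leq_eqVlt /= nth_rcons size_answers => /predU1P[->|it].
  by rewrite ltnn eqxx.
by rewrite it IH.
Qed.

Context dW (W : measurableType dW) (Z : W -> seed A) (xi : nat -> W -> sample O).
Context (mZ : measurable_fun setT Z) (mxi : forall t, measurable_fun setT (xi t)).

(** By strong induction: the history before step [t] consists of answers to earlier queries, packed
    as a tuple to compose with [next_measurable]. *)
Lemma query_measurable t :
  measurable_fun setT (fun w => query (Z w) (xi^~ w) t : borel_rV R d).
Proof.
have [n] := ubnP t; elim: n t => // n IH t /ltnSE tn.
have sz w : size (answers (Z w) (xi^~ w) t) == t by rewrite size_answers.
pose h w : t.-tuple (measurable_answer R d q) := Tuple (sz w).
have mh : measurable_fun setT h.
  apply/measurable_fun_tnthP => i.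
  rewrite (_ : _ \o _ = fun w => respond O (query (Z w) (xi^~ w) i) (xi i w)); last first.
    apply/funext => w /=.
    (* The default of [nth] is arbitrary, as [i < t]. *)
    by rewrite (tnth_nth (respond O 0 (xi 0 w))) /= nth_answers.
  have mq := IH i (leq_trans (ltn_ord i) tn).
  have mqx := measurable_fun_pair mq (mxi i).
  have mr := measurableT_comp (@respond_measurable R d q O) mqx.
  exact: mr.
exact: (measurableT_comp (@next_measurable R d q A t) (measurable_fun_pair mZ mh)).
Qed.

End Execution.

Section HardLowerBound.
Context (R : realType) (q d : nat) (alpha mu rho : R).
Context (rho_gt0 : 0 < rho) (rho_le1 : rho <= 1).
Context (alpha_gt0 : 0 < alpha) (mu_gt0 : 0 < mu).
Local Notation F := (@hard R q alpha mu d).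
Local Notation O := (hard_oracle q d alpha mu rho).

Lemma stationary_hard_closed eps : closed [set x | stationary eps F x].
Proof.
have -> : [set x | stationary eps F x] = (fun x =>
    Num.sqrt (\sum_(i < d) partials F [:: i] x ^+ 2)) @^-1` [set r | r <= eps].
  apply: eq_set => x; rewrite /stationary /enorm.
  by under eq_bigr do rewrite /grad mxE.
apply: preimage_closed; last exact: closed_le.
move=> x _; apply: (continuous_comp
  (f := fun x => \sum_(i < d) partials F [:: i] x ^+ 2)); last exact: sqrt_continuous.
apply: differentiable_continuous.
rewrite (_ : (fun _ => _) = \sum_(i < d) partials F [:: i] ^+ 2); last first.
  by apply/funext => u; rewrite fct_sumE.
apply: differentiable_sum => i; apply: differentiableX.
by rewrite partials_chain; exact: differentiable_chain.
Qed.

(** By strong induction: the answer at time [l < t] reaches at most one coordinate beyond those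
    allowed by the successes before [l], and only if [xi l] is a success. *)
Lemma vsupp_query (A : algorithm R d q) (z : seed A) (xi : nat -> bool) :
  (forall t, vsupp (query (O := O) z xi t) `<=` \bigcup_(i in [set i | (i < t)%N])
     asupp (respond O (query (O := O) z xi i) (xi i))) ->
  forall t, vsupp (query (O := O) z xi t) `<=`
    [set i | (i < \sum_(l < t) xi l)%N].
Proof.
move=> zr t; have [n] := ubnP t; elim: n t => // n IH t /ltnSE tn i /zr[l /= lt].
move=> /(asupp_hard_respond (IH l (leq_trans lt tn))) /= /leq_trans; apply.
rewrite -[X in (_ <= X)%N](big_mkord xpredT (fun l => xi l : nat)).
rewrite (@big_cat_nat _ _ _ l.+1) //= big_nat_recr //= big_mkord.
exact: leq_addr.
Qed.

(** Outside a null set and the event [E] of [d] successes among the first [n] samples, every query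
    up to time [N] has last coordinate [0], and [hard_gradient] applies. *)
Lemma hard_requires_queries (A : algorithm R d q) (eps N : R) :
  (0 < d)%N -> eps < alpha * mu * 2 ^- q.+2 -> 0 <= N -> N * rho <= d%:R / 2 ->
  zero_respecting A -> requires_queries F O A eps 2^-1 N.
Proof.
move=> d_gt0 eps_lt N0 N_le zr dW W P Z xi indep.
have [mZ mxi law] := indep.
set G := [set w | _].
have mG : measurable G.
  rewrite (_ : G = \bigcap_(t in [set t | t%:R <= N])
      (fun w => query (O := O) (Z w) (xi^~ w) t) @^-1` (~` [set x | stationary eps F x])).
    apply: bigcap_measurable => [|t _]; first by exists 0%N.
    rewrite -[X in measurable X]setTI; apply: query_measurable => //.
    apply: measurableC; apply: closed_measurable_rV; exact: stationary_hard_closed.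
  by [].
pose B i := xi i @^-1` [set true].
have mB i : measurable (B i) by rewrite -[B i]setTI; exact: mxi.
have PB i : P (B i) = rho%:E.
  (* The law of one sample is read off the joint law, all other constraints being trivial. *)
  pose C l := if l == i then [set true] else [set: bool].
  have := law i.+1 setT C measurableT (fun l => I).
  rewrite preimage_setT setTI probability_setT mul1e => lawi.
  have -> : B i = \bigcap_(t in [set t | (t < i.+1)%N]) (xi t @^-1` C t).
    apply/seteqP; split=> [w Bw l _|w /(_ i (ltnSn i))]; rewrite /C /=.
      by case: eqP => [->|].
    by rewrite eqxx.
  rewrite lawi big_ord_recr /= big1 => [|l _]; last first.
    rewrite /C (_ : _ == _ = false) ?probability_setT //; apply/eqP.
    by have := ltn_ord l; lia.
  rewrite mul1e /C eqxx bernoulli_probE ?(ltW rho_gt0) //.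
  by rewrite !diracE mem_set // memNset // mule1 mule0 adde0.
have tF : times_differentiable q F by exact: chain_times_differentiable.
have [nullS [mS PS0 nullSP]] := zr F O tF
   (@hard_oracle_for R q d alpha mu rho rho_gt0 rho_le1) _ _ _ _ _ indep.
set n := Num.truncn N.
pose E := [set w | (d%:R : R) <= \sum_(i < n) \1_(B i) w].
have mE : measurable E by exact: measurable_count.
have GES : setT `<=` G `|` (E `|` nullS).
  move=> w _; have [|wS] := pselect (nullS w); first by right; right.
  have [|wE] := pselect (E w); first by right; left.
  left=> t tN; have {}wS := contrapT (contra_not (nullSP w) wS).
  have tn : (t <= n)%N by rewrite truncn_ge_nat.
  have count_lt : (\sum_(l < t) xi l w < d)%N.
    rewrite ltnNge; apply/negP => dt; apply: wE; rewrite /E /=.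
    apply: (@le_trans _ _ (\sum_(l < t) xi l w)%:R); first by rewrite ler_nat.
    rewrite natr_sum -(big_mkord xpredT (fun l => (xi l w)%:R)).
    rewrite -(big_mkord xpredT (fun l => \1_(B l) w)).
    rewrite [leRHS](@big_cat_nat _ _ _ t) //=.
    rewrite -[leLHS]addr0; apply: lerD; last by apply: sumr_ge0.
    apply: ler_sum => l _; rewrite indicE.
    by case: (boolP (xi l w)) => // xil; rewrite mem_set.
  have dP : (d.-1 < d)%N by rewrite prednK.
  have x0 : query (O := O) (Z w) (xi^~ w) t 0 (Ordinal dP) = 0.
    apply: contrapT => xn0; have /= := @vsupp_query A _ _ wS t _ xn0.
    apply/negP; rewrite -leqNgt.
    by rewrite -ltnS prednK.
  rewrite /stationary; apply/negP; rewrite -ltNge.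
  apply: lt_le_trans eps_lt _; exact: hard_gradient x0.
(* By Markov, [d * P E <= n * rho <= N * rho <= d / 2]. *)
have PE : (P E <= (2^-1)%:E)%E.
  have := count_markov P mB n (ler0n R d).
  under eq_bigr do rewrite PB.
  rewrite sumEFin sumr_const card_ord -/E => hE.
  rewrite -(@lee_pmul2l _ d%:R%:E) ?lte_fin ?ltr0n //.
  apply: le_trans hE _; rewrite -EFinM lee_fin -[rho *+ n]mulr_natl.
  apply: (le_trans _ N_le); rewrite ler_wpM2r ?(ltW rho_gt0) //.
  by rewrite truncn_le.
have P1 : (1 <= P G + (P E + 0))%E.
  rewrite -(probability_setT P); apply: le_trans (le_measure P _ _ GES) _.
  - by rewrite inE.
  - by rewrite inE; apply: measurableU => //; exact: measurableU.
  apply: le_trans (measureU2 _ _ _) _ => //; first exact: measurableU.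
  by rewrite leeD2l // -PS0; apply: measureU2.
rewrite adde0 in P1.
have : (1 <= P G + (2^-1)%:E)%E by apply: le_trans P1 _; rewrite leeD2l.
rewrite -leeBlDr // => half; apply: le_trans half.
by rewrite -EFinB lee_fin; lra.
Qed.

End HardLowerBound.

(** * Choice of the parameters *)

Section Meps.
Context (R : realType) (q : nat) (q_gt0 : (1 <= q)%N) (L sigma : nat -> R).
Context (L_gt0 : forall r, (1 <= r <= q)%N -> 0 < L r).
Context (sigma_gt0 : forall r, (1 <= r <= q)%N -> 0 < sigma r).

Let Meps_ereal (eps : R) : \bar R := Order.min
  (\big[Order.min/+oo%E]_(2 <= r < q.+1)
     ((sigma r / sigma 1%N) `^ (r.-1%:R)^-1)%:E)
  (\big[Order.min/+oo%E]_(1 <= r < q.+1) ((L r / eps) `^ (r%:R)^-1)%:E).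

Let Meps_gt0E eps : 0 < eps -> (0 < Meps_ereal eps)%E.
Proof.
move=> e0; rewrite /Meps_ereal lt_min; apply/andP; split; rewrite big_nat;
  apply: lt_bigmin => // r rq; rewrite lte_fin powR_gt0 // divr_gt0 //.
- by apply: sigma_gt0; lia.
- by apply: sigma_gt0; lia.
- by apply: L_gt0; lia.
Qed.

Let Meps_leL eps r : (1 <= r <= q)%N ->
  (Meps_ereal eps <= ((L r / eps) `^ (r%:R)^-1)%:E)%E.
Proof.
move=> rq; rewrite /Meps_ereal ge_min; apply/orP; right.
by apply: ge_bigmin_seq => //; rewrite mem_index_iota ltnS.
Qed.

(** The term [r = 1] of the second minimum, present as [q >= 1], is a finite upper bound. *)
Let Meps_fin eps : 0 < eps -> Meps_ereal eps = (M_eps q L sigma eps)%:E.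
Proof.
move=> e0; rewrite -[LHS]fineK // ge0_fin_numE; last exact/ltW/Meps_gt0E.
by apply: le_lt_trans (Meps_leL eps (r := 1) _) (ltry _); rewrite leqnn.
Qed.

Lemma M_eps_gt0 eps : 0 < eps -> 0 < M_eps q L sigma eps.
Proof. by move=> e0; rewrite -lte_fin -Meps_fin // Meps_gt0E. Qed.

Lemma M_eps_L eps r : 0 < eps -> (1 <= r <= q)%N ->
  M_eps q L sigma eps ^+ r <= L r / eps.
Proof.
move=> e0 rq; have M0 := M_eps_gt0 e0.
have := Meps_leL eps rq; rewrite Meps_fin // lee_fin.
have Le0 : 0 < L r / eps by rewrite divr_gt0 // L_gt0.
move=> /(@lerXn2r _ r); rewrite !nnegrE => /(_ (ltW M0) (powR_ge0 _ _)) /le_trans; apply.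
rewrite -powR_mulrn ?powR_ge0 // -powRrM mulVf ?powRr1 ?(ltW Le0) // pnatr_eq0; lia.
Qed.

Lemma M_eps_sigma eps r : 0 < eps -> (1 <= r)%N -> (r.+1 <= q)%N ->
  M_eps q L sigma eps ^+ r <= sigma r.+1 / sigma 1.
Proof.
move=> e0 r1 rq; have M0 := M_eps_gt0 e0.
have : (Meps_ereal eps <= ((sigma r.+1 / sigma 1%N) `^ (r.+1.-1%:R)^-1)%:E)%E.
  rewrite /Meps_ereal ge_min; apply/orP; left.
  by apply: ge_bigmin_seq => //; rewrite mem_index_iota; lia.
rewrite Meps_fin // lee_fin /=.
have se0 : 0 < sigma r.+1 / sigma 1 by rewrite divr_gt0 // sigma_gt0 //; lia.
move=> /(@lerXn2r _ r); rewrite !nnegrE => /(_ (ltW M0) (powR_ge0 _ _)) /le_trans; apply.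
rewrite -powR_mulrn ?powR_ge0 // -powRrM mulVf ?powRr1 ?(ltW se0) // pnatr_eq0; lia.
Qed.

(** Only the terms in [L r / eps] move with [eps]. The value at [1] thus bounds [M_eps] from below
    for [eps <= 1], which yields the threshold [eps0]. *)
Lemma M_eps_nonincreasing eps eps' : 0 < eps -> eps <= eps' ->
  M_eps q L sigma eps' <= M_eps q L sigma eps.
Proof.
move=> e0 ee'; have e'0 := lt_le_trans e0 ee'.
rewrite -lee_fin -!Meps_fin // /Meps_ereal le_min; apply/andP; split.
  by rewrite ge_min lexx.
rewrite [leRHS]big_nat; apply: le_bigmin => [|r /andP[r1 rq]]; first exact: leey.
have rq' : (1 <= r <= q)%N by rewrite r1 -ltnS.
apply: le_trans (Meps_leL eps' rq') _; rewrite lee_fin.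
have Lr := L_gt0 rq'.
apply: ge0_ler_powR; rewrite ?nnegrE ?invr_ge0 ?ler0n //.
- by rewrite ltW // divr_gt0.
- by rewrite ltW // divr_gt0.
- by rewrite ler_pM2l // lef_pV2 ?posrE.
Qed.

End Meps.

(** The values lie in an interval symmetric about [0], whose length bounds [F 0 - inf F]. *)
Lemma hard_function_class (R : realType) (q d : nat) (alpha mu C Delta : R)
    (L : nat -> R) : 0 <= alpha -> 0 <= mu ->
  (forall a k u, (k <= q.+1)%N -> `|tower (@hardU R q a) k u| <= C) ->
  (forall k u, (k <= q.+1)%N -> `|tower (@hardV R q) k u| <= C) ->
  (forall k u, (k <= q.+1)%N -> `|tower ('X : {poly R}) k u| <= C) ->
  2 * (alpha * (C + C ^+ 2)) * d%:R <= Delta ->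
  (forall k, (k < q)%N ->
     alpha * mu ^+ k.+2 * ((C + C ^+ 2) * 2 ^+ k.+2) <= L k.+1) ->
  function_class q Delta L (@hard R q alpha mu d).
Proof.
move=> alpha0 mu0 CU CV CW hDelta hL.
have boundF (x : 'rV[R]_d) : `|hard q alpha mu x| <= alpha * (C + C ^+ 2) * d%:R.
  have := @chain_entry_bounded R (@hardU R q) (@hardV R q) 'X alpha mu C d q
    alpha0 mu0 CU CV CW [::] x (leq0n _).
  rewrite /= expr0 mulr1 mul1r sumr_const card_ord -[alpha * _ *+ d]mulr_natr; exact.
have lbF : lbound (range (@hard R q alpha mu d)) (- (alpha * (C + C ^+ 2) * d%:R)).
  by move=> _ [x _ <-]; have := boundF x; rewrite ler_norml => /andP[].
split.
- exact: chain_times_differentiable.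
- by exists (- (alpha * (C + C ^+ 2) * d%:R)).
- apply: le_trans hDelta; have := boundF 0; rewrite ler_norml => /andP[_ F0].
  have : - (alpha * (C + C ^+ 2) * d%:R) <= inf (range (@hard R q alpha mu d)).
    by apply: lb_le_inf => //; exists (@hard R q alpha mu d 0), 0.
  by move: F0; lra.
- move=> [//|k] kq x y; apply: le_trans (chain_lipschitz alpha0 mu0 CU CV CW _ _ kq) _.
  by rewrite ler_wpM2r ?enorm_ge0 // hL.
Qed.

Theorem theorem1 (R : realType) :
  exists2 pi0 : R, 0 < pi0 &
  forall (q : nat) (p : R), (1 <= q)%N -> 1 < p <= 2 ->
  exists kappa c c1 c2 : R,
    [/\ 0 < kappa, 0 < c, 0 < c1 & 0 < c2] /\
  forall (Delta : R) (L sigma : nat -> R),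
    0 < Delta -> (forall r, (1 <= r <= q)%N -> 0 < L r /\ 0 < sigma r) ->
  exists2 eps0 : R, 0 < eps0 &
  forall eps : R, 0 < eps <= eps0 -> eps <= kappa * sigma 1%N ->
  exists (d : nat) (F : 'rV[R]_d -> R) (O : oracle R d q),
    [/\ function_class q Delta L F,
        oracle_class p sigma F O,
        c1 * (Delta / eps * M_eps q L sigma eps) <= d%:R
          <= c2 * (Delta / eps * M_eps q L sigma eps) &
        forall A : algorithm R d q, zero_respecting A ->
          requires_queries F O A eps pi0
            (c * (Delta / eps * (sigma 1%N / eps) `^ (p / (p - 1))
                  * M_eps q L sigma eps))].
Proof.
exists 2^-1 => // q p q1 /andP[p1 p2].
have p_ge0 : 0 <= p by lra.
have p1_gt0 : 0 < p - 1 by lra.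
(* Absorbs the factor [2] of [bernoulli_centered_moment]. *)
have half_pow : 2 * (2^-1 : R) `^ p <= 1.
  have : (2^-1 : R) `^ p <= 2^-1 by rewrite ge1r_powR ?ltW //; lra.
  lra.
have [C C0 [CU CV CW]] := @hard_tower_bounded R q.
(* Constants are introduced through equations, so that they stay opaque. [K1] dominates
   [K * 2 ^+ k.+2] for all [k < q]. *)
have [K KE] : {K | K = C + C ^+ 2} by eexists.
have K0 : 0 <= K by rewrite KE addr_ge0 ?sqr_ge0.
have [K1 K1E] : {K1 | K1 = (K + 1) * 2 ^+ q.+2} by eexists.
have K1_ge1 : 1 <= K1 by rewrite K1E mulr_ege1 ?exprn_ege1 //; lra.
have K_le k : (k < q)%N -> K * 2 ^+ k.+2 <= K1.
  move=> kq; rewrite K1E; apply: ler_pM; rewrite ?exprn_ge0 ?lerDl //.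
  by apply: ler_weXn2l; [lra | lia].
have K_le1 : K <= K1.
  apply: (@le_trans _ _ (K + 1)); first lra.
  by rewrite K1E ler_peMr ?exprn_ege1 //; lra.
(* Twice the inverse of the constant in [hard_gradient]: with [alpha * mu = G * eps], the gradient
   at a point with a zero coordinate has norm at least [2 * eps]. *)
have [G GE] : {G : R | G = 2 ^+ q.+3} by eexists.
have G_ge1 : 1 <= G by rewrite GE exprn_ege1 //; lra.
have [theta thetaE] : {z | z = 2 * G * K1} by eexists.
have GK_ge1 : 1 <= G * K1 by rewrite mulr_ege1.
have G_gt0 : 0 < G by lra.
have K1_gt0 : 0 < K1 by lra.
have GK_gt0 : 0 < G * K1 by rewrite mulr_gt0.
have theta_gt0 : 0 < theta by rewrite thetaE -mulrA mulr_gt0.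
(* Chosen so that the bound [2 * (alpha * K1) * d] equals [Delta] at [d = X / B]. *)
have [B BE] : {z | z = 2 * (G * K1) ^+ 2} by eexists.
have B_gt0 : 0 < B by rewrite BE mulr_gt0 // exprn_gt0.
have [p' p'E] : {z | z = p / (p - 1)} by eexists.
have thp_gt0 : 0 < theta `^ p' by rewrite powR_gt0.
(* [theta^-1] ensures [S >= 1], the next constant gives [N * rho = X / (4 * B)], and the last two
   come from rounding [X / B]. *)
exists theta^-1, (4 * B * theta `^ p')^-1, (2 * B)^-1, B^-1.
split; first by split; rewrite invr_gt0 // ?mulr_gt0.
move=> Delta L sigma Delta_gt0 Lsigma.
have L_gt0 r : (1 <= r <= q)%N -> 0 < L r by case/Lsigma.
have sigma_gt0 r : (1 <= r <= q)%N -> 0 < sigma r by case/Lsigma.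
have sigma1_gt0 : 0 < sigma 1%N by rewrite sigma_gt0 ?q1.
have [M1 M1E] : {z | z = M_eps q L sigma 1} by eexists.
have M1_gt0 : 0 < M1 by rewrite M1E; exact: M_eps_gt0.
(* Ensures [1 <= X / B], so that rounding down leaves [d > 0] and loses at most a factor [2]. *)
exists (Num.min 1 (Delta * M1 / B)).
  by rewrite lt_min ltr01 divr_gt0 ?mulr_gt0.
move=> eps /andP[eps_gt0]; rewrite le_min => /andP[eps_le1 eps_le] eps_sigma.
have [M ME] : {z | z = M_eps q L sigma eps} by eexists.
rewrite -!ME.
have M_gt0 : 0 < M by rewrite ME; exact: M_eps_gt0.
have [X XE] : {z | z = Delta / eps * M} by eexists.
have X_gt0 : 0 < X by rewrite XE mulr_gt0 ?divr_gt0.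
have X_ge : 1 <= X / B.
  rewrite ler_pdivlMr // mul1r.
  have M1M : M1 <= M by rewrite ME M1E; exact: M_eps_nonincreasing.
  rewrite XE; apply: (@le_trans _ _ (Delta / eps * M1)); last first.
    by rewrite ler_wpM2l // divr_ge0 // ltW.
  by rewrite mulrAC ler_pdivlMr // mulrC -ler_pdivlMr.
have [d dE] : {z | z = Num.truncn (X / B)} by eexists.
have d_le : d%:R <= X / B by rewrite dE truncn_le (le_trans ler01 X_ge).
have d_gt0 : (0 < d)%N by rewrite dE truncn_gt0.
have X_le : X / B <= 2 * d%:R.
  have := real_truncnS_gt (num_real (X / B)); rewrite -dE -natr1.
  by have : 1 <= d%:R :> R by [rewrite ler1n]; lra.
(* As [mu <= M], powers of [mu] obey the constraints by [L r / eps] and [sigma r / sigma 1] built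
   into [M]; [alpha] then fixes the gradient scale [G * eps]. *)
have [mu muE] : {z | z = M / (G * K1)} by eexists.
have [alpha alphaE] : {z | z = G * eps / mu} by eexists.
have mu_gt0 : 0 < mu by rewrite muE divr_gt0.
have alpha_gt0 : 0 < alpha by rewrite alphaE divr_gt0 // mulr_gt0.
have mu_le : mu <= M by rewrite muE ler_pdivrMr ?ler_peMr ?(ltW M_gt0).
have muM k : mu ^+ k <= M ^+ k.
  by apply: lerXn2r mu_le; rewrite nnegrE ltW.
have alphamu k : alpha * mu ^+ k.+1 = G * eps * mu ^+ k.
  by rewrite exprS mulrA alphaE divfK ?gt_eqF.
(* With [rho = S^(-p')] the moment factor [rho^(1-p)] is [S^p], so the noise condition reduces to
   [S * b <= sigma k.+1 / 2]. *)
have [S SE] : {z | z = sigma 1%N / (theta * eps)} by eexists.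
have S_ge1 : 1 <= S.
  rewrite SE ler_pdivlMr ?mulr_gt0 // mul1r.
  by rewrite -ler_pdivlMl.
have S_gt0 : 0 < S by exact: lt_le_trans S_ge1.
have [rho rhoE] : {z | z = (S `^ p')^-1} by eexists.
have p'_ge0 : 0 <= p' by rewrite p'E divr_ge0 // ltW.
have Sp_ge1 : 1 <= S `^ p' by rewrite -[leLHS](powRr0 S) ler_powR.
have rho_gt0 : 0 < rho by rewrite rhoE invr_gt0 powR_gt0.
have rho_le1 : rho <= 1 by rewrite rhoE invf_le1 // powR_gt0.
have rho_pow : rho^-1 `^ (p - 1) = S `^ p.
  by rewrite rhoE invrK p'E -powRrM divfK // subr_eq0 gt_eqF.
exists d, (@hard R q alpha mu d), (hard_oracle q d alpha mu rho); split.
- apply: (hard_function_class (ltW alpha_gt0) (ltW mu_gt0) CU CV CW) => [|k kq].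
    apply: (@le_trans _ _ (2 * (alpha * K1) * (X / B))).
      rewrite -KE; apply: ler_pM => //; first by rewrite mulr_ge0 // mulr_ge0 // ltW.
      by rewrite ler_pM2l // ler_pM2l.
    rewrite le_eqVlt; apply/orP; left; apply/eqP; rewrite alphaE muE XE BE.
    by field; rewrite !gt_eqF.
  rewrite -KE alphamu.
  apply: (@le_trans _ _ (G * eps * mu ^+ k.+1 * K1)).
    rewrite ler_wpM2l ?K_le // mulr_ge0 ?exprn_ge0 ?(ltW mu_gt0) //.
    by rewrite mulr_ge0 ?(ltW eps_gt0) ?(ltW G_gt0).
  have := M_eps_L q1 L_gt0 sigma_gt0 eps_gt0 (r := k.+1) kq.
  rewrite -ME ler_pdivlMr // => ML; apply: le_trans ML.
  have GKmu : G * K1 * mu = M by rewrite muE mulrC divfK // gt_eqF.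
  rewrite (_ : G * eps * mu ^+ k.+1 * K1 = M * eps * mu ^+ k); last first.
    by rewrite -GKmu exprS; ring.
  by rewrite exprS [leRHS]mulrAC ler_wpM2l // mulr_ge0 ?(ltW M_gt0) ?(ltW eps_gt0).
- apply: (@hard_oracle_in_class R q d alpha mu rho rho_gt0 rho_le1 C p sigma
    (ltW alpha_gt0) (ltW mu_gt0) (ltW p1) CU CV CW).
  move=> k kq; rewrite -KE rho_pow alphamu.
  have s_gt0 : 0 < sigma k.+1 by apply: sigma_gt0.
  have Msig : M ^+ k <= sigma k.+1 / sigma 1%N.
    case: k kq {s_gt0} => [|k] kq; first by rewrite expr0 divff ?gt_eqF.
    by rewrite ME; exact: M_eps_sigma.
  have K2 : 0 <= K * 2 ^+ k.+2 by rewrite mulr_ge0 // exprn_ge0.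
  set b := G * eps * mu ^+ k * _.
  have b0 : 0 <= b.
    apply: mulr_ge0 => //; apply: mulr_ge0; last by rewrite exprn_ge0 // ltW.
    by rewrite mulr_ge0 ?(ltW eps_gt0) ?(ltW G_gt0).
  have Sb : S * b <= sigma k.+1 / 2.
    have Stheta : S * (G * eps * K1) = sigma 1%N / 2.
      by rewrite SE thetaE; field; rewrite !gt_eqF.
    apply: (@le_trans _ _ (sigma 1%N / 2 * M ^+ k)); last first.
      by move: Msig; rewrite ler_pdivlMr // => Msig; lra.
    rewrite -Stheta -mulrA ler_wpM2l ?(ltW S_gt0) // /b -!mulrA.
    rewrite ler_wpM2l ?(ltW G_gt0) //.
    rewrite ler_wpM2l ?(ltW eps_gt0) // mulrC.
    by apply: ler_pM; rewrite ?K_le // exprn_ge0 // ltW.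
  rewrite -mulrA -powRM ?(ltW S_gt0) //.
  apply: (@le_trans _ _ (2 * (sigma k.+1 / 2) `^ p)).
    rewrite ler_pM2l // ge0_ler_powR ?nnegrE //; first by rewrite mulr_ge0 // ltW.
    by rewrite divr_ge0 // ltW.
  rewrite powRM ?(ltW s_gt0) ?invr_ge0 // mulrCA -[leRHS]mulr1.
  by rewrite ler_wpM2l ?powR_ge0.
- rewrite -XE; apply/andP; split; last by rewrite mulrC.
  by rewrite invfM -mulrA [B^-1 * _]mulrC ler_pdivrMl.
- move=> A zr.
  set N := _ * _.
  have NE : N = X / (4 * B) * S `^ p'.
    rewrite /N XE.
    have -> : sigma 1%N / eps = theta * S by rewrite SE; field; rewrite !gt_eqF.
    by rewrite powRM ?(ltW theta_gt0) ?(ltW S_gt0) // -p'E; field; rewrite !gt_eqF.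
  apply: hard_requires_queries => //.
  + have := alphamu 0%N; rewrite expr1 expr0 mulr1 => ->.
    rewrite GE exprS mulrAC mulfK ?expf_neq0 ?pnatr_eq0 // mulr_natl mulr2n.
    by rewrite ltrDl.
  + by rewrite NE mulr_ge0 ?powR_ge0 // divr_ge0 ?(ltW X_gt0) // ltW // mulr_gt0.
  + rewrite NE rhoE mulfK ?gt_eqF ?powR_gt0 // invfM mulrA mulrAC.
    by move: X_le; lra.
Qed.
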